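(* Let $T>0$, let $[f_n]\in\mathcal{H}$ and let $B$ be a standard Brownian motion with $B_0=0$. Then $g_t=[\mathbb{E}(f_n(B_t+\cdot))]$, i.e. the class $g$ of the sequence of functions $(t,x)\mapsto\mathbb{E}(f_n(B_t+x))$ on $[0,T]\times\mathbb{R}$, belongs to $\mathcal{H}_T$ and solves the Cauchy problem $$D_tg=\frac12D_x^2g,\qquad g_0=[f_n].$$
   Context: $\mathbb{N}_0=\mathbb{N}\cup\{0\}$. $\mathcal{S}$ is the Schwartz space of rapidly decreasing smooth real-valued functions on $\mathbb{R}$, with norms $\|\varphi\|_m=\big(\int_{\mathbb{R}}|(N+1)^m\varphi(x)|^2dx\big)^{1/2}$, $m\in\mathbb{N}_0$, where $N+1=\frac12\big(-\frac{d^2}{dx^2}+x^2+1\big)$. $\mathbf{s}$ is the space of real sequences $(a_n)_{n\in\mathbb{N}_0}$ with $\sum_n (n+1)^{2m}|a_n|^2<\infty$ for all $m\in\mathbb{N}_0$. $\mathbf{s}'$ is the space of real sequences $(b_n)$ for which there are $C\in\mathbb{R}$, $m\in\mathbb{N}_0$ with $|b_n|\le C(n+1)^m$ for all $n$. $\mathcal{H}_{\mathbf{s}'}$ (resp. $\mathcal{H}_{\mathbf{s}}$) is the set of sequences $(f_n)\in\mathcal{S}^{\mathbb{N}_0}$ such that $(\|f_n\|_m)_n\in\mathbf{s}'$ (resp. $\in\mathbf{s}$) for every $m\in\mathbb{N}_0$. The tempered algebra is $\mathcal{H}=\mathcal{H}_{\mathbf{s}'}/\mathcal{H}_{\mathbf{s}}$;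 $[f_n]$ is the class of $(f_n)$. $\mathcal{S}_T$ is the set of functions $f:[0,T]\times\mathbb{R}\to\mathbb{R}$ with $f(t,\cdot)\in\mathcal{S}$ for each $t\in[0,T]$ and $f(\cdot,x)\in C^1([0,T])$ for each $x\in\mathbb{R}$. $\mathcal{H}^T_{\mathbf{s}'}$ (resp. $\mathcal{H}^T_{\mathbf{s}}$) is the set of $(f_n)\in\mathcal{S}_T^{\mathbb{N}_0}$ such that for each $m\in\mathbb{N}_0$ the sequences $\big(\sup_{t\in[0,T]}\|f_n(t,\cdot)\|_m\big)_n$ and $\big(\sup_{t\in[0,T]}\|\frac{\partial f_n}{\partial t}(t,\cdot)\|_m\big)_n$ both belong to $\mathbf{s}'$ (resp. $\mathbf{s}$) (in particular these norms are required to be defined, with $\frac{\partial f_n}{\partial t}(t,\cdot)\in\mathcal{S}$). $\mathcal{H}_T=\mathcal{H}^T_{\mathbf{s}'}/\mathcal{H}^T_{\mathbf{s}}$. For $g=[g_n]\in\mathcal{H}_T$ and $t\in[0,T]$: $g_t=[g_n(t,\cdot)]\in\mathcal{H}$, $D_tg=[\frac{\partial}{\partial t}g_n(t,\cdot)]\in\mathcal{H}$, and $D_x^2g=[\frac{\partial^2}{\partial x^2}g_n(t,\cdot)]\in\mathcal{H}$; the equation $D_tg=\frac12D_x^2g$ is an equality in $\mathcal{H}$ for every $t\in[0,T]$. *)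

(* Defs.v *)
From HB Require Import structures.
From mathcomp Require Import all_boot all_order all_algebra.
From mathcomp Require Import all_classical all_reals all_analysis.

Set Implicit Arguments.
Unset Strict Implicit.
Unset Printing Implicit Defensive.

Import Order.TTheory GRing.Theory Num.Theory.
Import numFieldNormedType.Exports.

Local Open Scope ring_scope.
Local Open Scope classical_set_scope.

Section SequenceSpaces.
Context {R : realType}.

Definition rapid_seq (a : nat -> R) : Prop :=
  forall m : nat,
    (\sum_(0 <= n <oo) (n.+1%:R ^+ (2 * m) * `|a n| ^+ 2)%:E < +oo)%E.

Definition slow_seq (b : nat -> R) : Prop :=
  exists (C : R) (m : nat), forall n, `|b n| <= C * n.+1%:R ^+ m.

End SequenceSpaces.

Section TemperedAlgebra.
Context {R : realType}.

Definition schwartz (phi : R -> R) : Prop :=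
  (forall (k : nat) (x : R), derivable (derive1n k phi) x 1) /\
  (forall j k : nat, exists C : R, forall x, `|x ^+ j * derive1n k phi x| <= C).

(* The operator N + 1, where N = (- d^2/dx^2 + x^2 - 1) / 2. *)
Definition oscillator (phi : R -> R) : R -> R :=
  fun x => 2^-1 * (- derive1n 2 phi x + x ^+ 2 * phi x + phi x).

Definition snorm (m : nat) (phi : R -> R) : R :=
  Num.sqrt
    (\int[lebesgue_measure]_(x in [set: R]) `|iter m oscillator phi x| ^+ 2).

(* [tempered_seq slow_seq] is H_{s'} and [tempered_seq rapid_seq] is H_s. *)
Definition tempered_seq (S : (nat -> R) -> Prop) (f : nat -> R -> R) : Prop :=
  (forall n, schwartz (f n)) /\ (forall m, S (fun n => snorm m (f n))).

(* The coset f + H_s; elements of the quotient are such cosets, so equality in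
   the quotient is equality of sets. *)
Definition tclass (f : nat -> R -> R) : set (nat -> R -> R) :=
  [set h | tempered_seq rapid_seq (h - f)].

(* The operation on cosets induced by an operation [D] on representatives: when
   [D] respects the congruences, this is [tclass (D g)] for each g in [G]. *)
Definition induced (A : Type) (D : A -> nat -> R -> R) (G : set A) :
    set (nat -> R -> R) :=
  \bigcup_(g in G) tclass (D g).

Definition tscale (c : R) (F : set (nat -> R -> R)) : set (nat -> R -> R) :=
  induced (fun f n x => c * f n x) F.

End TemperedAlgebra.

(* Functions on [0, T] x R are represented by functions R -> R -> R (time
   first) of which only the values at times in [0, T] are ever used; two
   functions that agree there have the same class below. *)
Section TimeDependent.
Context {R : realType}.
Variable T : R.

Definition diff_quot (u : R -> R) (t : R) : R -> R :=
  fun s => (u s - u t) / (s - t).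

(* The derivative relative to [0, T], hence one-sided at 0 and T. *)
Definition derive_on (u : R -> R) (t : R) : R :=
  lim (diff_quot u t s @[s --> within `[0, T] t^']).

Definition C1_on (u : R -> R) : Prop :=
  (forall t, 0 <= t <= T ->
     cvg (diff_quot u t s @[s --> within `[0, T] t^'])) /\
  {within `[0, T], continuous (derive_on u)}.

Definition dt (u : R -> R -> R) : R -> R -> R :=
  fun t x => derive_on (u ^~ x) t.

Definition schwartz_on (u : R -> R -> R) : Prop :=
  (forall t, 0 <= t <= T -> schwartz (u t)) /\
  (forall x, C1_on (u ^~ x)).

(* The bound is required separately because [sup] is 0 on unbounded sets. *)
Definition sup_norms_in (S : (nat -> R) -> Prop) (m : nat)
    (f : nat -> R -> R -> R) : Prop :=
  let norms n := [set snorm m (f n t) | t in `[0, T]] in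
  (forall n, has_ubound (norms n)) /\ S (fun n => sup (norms n)).

(* [temperedT_seq slow_seq] is H^T_{s'} and [temperedT_seq rapid_seq] is
   H^T_s. *)
Definition temperedT_seq (S : (nat -> R) -> Prop) (f : nat -> R -> R -> R) :
    Prop :=
  [/\ forall n, schwartz_on (f n),
      forall n t, 0 <= t <= T -> schwartz (dt (f n) t),
      forall m, sup_norms_in S m f
    & forall m, sup_norms_in S m (fun n => dt (f n))].

Definition tclassT (f : nat -> R -> R -> R) : set (nat -> R -> R -> R) :=
  [set h | temperedT_seq rapid_seq (h - f)].

Definition tempered_algebraT : set (set (nat -> R -> R -> R)) :=
  tclassT @` [set f | temperedT_seq slow_seq f].

Definition at_time (t : R) (G : set (nat -> R -> R -> R)) :
    set (nat -> R -> R) :=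
  induced (fun g n => g n t) G.

Definition Dt (t : R) (G : set (nat -> R -> R -> R)) : set (nat -> R -> R) :=
  induced (fun g n => dt (g n) t) G.

Definition Dx2 (t : R) (G : set (nat -> R -> R -> R)) : set (nat -> R -> R) :=
  induced (fun g n => derive1n 2 (g n t)) G.

End TimeDependent.

Section BrownianMotion.
Context {R : realType} {d : measure_display} {Omega : measurableType d}.
Context {P : probability Omega R}.

(* The time set is [0, +oo[; the values of [B] at negative times are
   irrelevant. In [independent_increments] the [A i] may be the full line, so
   the product rule covers every subfamily of increments. *)
Definition independent_increments (B : R -> {RV P >-> R}) : Prop :=
  forall (k : nat) (t : nat -> R) (A : nat -> set R),
    0 <= t 0%N -> (forall i, t i <= t i.+1) ->
    (forall i, measurable (A i)) ->
    P [set w | forall i, (i < k)%N -> A i (B (t i.+1) w - B (t i) w)] =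
    (\prod_(i < k) P [set w | A i (B (t i.+1) w - B (t i) w)%R])%E.

(* The second parameter of [normal_prob] is the standard deviation. *)
Definition gaussian_increments (B : R -> {RV P >-> R}) : Prop :=
  forall (s t : R) (A : set R), 0 <= s -> s < t -> measurable A ->
    P [set w | A (B t w - B s w)] = normal_prob 0 (Num.sqrt (t - s)) A.

Definition standard_brownian_motion (B : R -> {RV P >-> R}) : Prop :=
  [/\ {ae P, forall w, B 0 w = 0},
      independent_increments B,
      gaussian_increments B
    & {ae P, forall w, {within `[0, +oo[, continuous (fun t => B t w)}}].

End BrownianMotion.

(* Main.v *)
Require Import Defs.
From HB Require Import structures.
From mathcomp Require Import all_boot all_order all_algebra.
From mathcomp Require Import all_classical all_reals all_analysis.
From mathcomp Require Import measurable_realfun ring lra.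

Set Implicit Arguments.
Unset Strict Implicit.
Unset Printing Implicit Defensive.

Import Order.TTheory GRing.Theory Num.Theory.
Import numFieldNormedType.Exports.

Local Open Scope ring_scope.
Local Open Scope classical_set_scope.

(** Since [B t] is centred Gaussian with variance [t], the representative
[gn n t] is the heat flow of [f n]: with [r = sqrt t] and [gauss] the standard
normal density it is [heat r (f n)], the function sending [x] to the integral
of [f n (x + r * y) * gauss y] ([brownian_heat]).  Everything then reduces to
three properties of the heat flow on Schwartz functions.

Moderate growth.  The norms of the statement are the L2 norms of
[iter m oscillator phi].  Integration by parts gives
[|phi'|^2 + |x phi|^2 <= |oscillator phi|^2], and the commutators of the
oscillator with derivation and with multiplication by [x] are again, up to
sign, multiplication by [x] and derivation; hence both operations are continuous
for these norms, at the cost of one more oscillator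
([snorm_derive1_mulX]).  The heat flow commutes with derivation, and Gaussian
integration by parts moves multiplication by [x] inside it:
[x * heat r phi = heat r (x * phi - r^2 * phi')] ([mulX_heat]).  So
[iter m oscillator (heat r phi)] is [heat r] applied to the image of [phi] under
a polynomial in [x], [d/dx] and [r^2], whose norm is controlled uniformly for
bounded [r]; and [heat r] contracts the L2 norm, by the Jensen and Tonelli theorems
and by translation invariance ([ip_heat]).  This yields [tempered_heat], and
with it the membership of [g] in the algebra over [[0, T]].

The equation.  For [t > 0] the derivative in [t] of [heat (sqrt t) phi x] is
[2^-1 * heat (sqrt t) phi'' x] by the chain rule, since the derivative in [r] of
[heat r phi x] is [r * heat r phi'' x], again by Gaussian integration by parts.
At [t = 0] the square root is not differentiable, but the right-hand side is
continuous up to [0] and the mean value theorem extends the identity there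
([heat_equation], [cvg_diff_quot]).  The equation thus holds between
representatives, not only modulo rapidly decreasing sequences.

Cosets.  Restriction to a time, the two derivations and scaling respect the
congruences, so each can be computed on the representative [gn]
([induced_eq]). *)

(** * Integrals of derivatives of decaying functions *)

Section Decay.
Context {R : realType}.
Local Notation mu := (@lebesgue_measure R).
Implicit Types h F : R -> R.

(** This rate is integrable and vanishes at infinity.  Products of two Schwartz
functions meet it, and so does the Gaussian density times a function of at most
quadratic growth. *)
Definition decays h := exists C : R, forall x, `|h x| <= C / (1 + x ^+ 2).

Lemma integrable_oneDsqrV :
  mu.-integrable setT (EFin \o (fun x : R => (1 + x ^+ 2)^-1)).
Proof.
have cV : continuous (fun x : R => (1 + x ^+ 2)^-1).
  exact: (@continuous_oneDsqrV R).
have V0 x : 0 <= (1 + x ^+ 2)^-1 :> R.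
  by rewrite invr_ge0 addr_ge0 ?sqr_ge0.
apply/integrableP; split.
  by apply/measurable_EFinP; exact: continuous_measurable_fun.
under eq_integral do rewrite /= ger0_norm//.
rewrite ge0_symfun_integralT//=; last by move=> x; rewrite /= sqrrN.
have -> : [set x : R | 0 <= x] = `[0, +oo[%classic.
  by apply/seteqP; split=> x /=; rewrite in_itv/= andbT.
by rewrite (@integral0y_oneDsqr R) -EFinM ltry.
Qed.

Lemma decays_integrable h :
  continuous h -> decays h -> mu.-integrable setT (EFin \o h).
Proof.
move=> ch [C hC].
apply: (@le_integrable _ _ _ mu setT measurableT _
  (fun x => C%:E * ((1 + x ^+ 2)^-1)%:E)%E).
- by apply/measurable_EFinP; exact: continuous_measurable_fun.
- move=> x _ /=; rewrite lee_fin; apply: le_trans (hC x) _; exact: ler_norm.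
- exact: integrableZl integrable_oneDsqrV.
Qed.

(** The integral of [F'] over [[-n, n]] is [F n - F (-n)], which tends to [0];
dominated convergence identifies its limit with the integral over the line.
All the integrations by parts below are instances. *)
Lemma Rintegral_derive1_eq0 F : (forall x, derivable F x 1) ->
  continuous (derive1 F) -> decays F -> decays (derive1 F) ->
  \int[mu]_x derive1 F x = 0.
Proof.
move=> dF cF' [C FC] decF'.
have cF : continuous F.
  by move=> x; exact/differentiable_continuous/derivable1_diffP.
have intF' := decays_integrable cF' decF'.
pose A n : set R := `[- n%:R, n%:R]%classic.
have FTC n : (0 < n)%N -> (\int[mu]_(x in A n) (derive1 F x)%:E =
    (F n%:R - F (- n%:R))%:E)%E.
  move=> n0; rewrite EFinB; apply: (@continuous_FTC2 _ (derive1 F) F).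
  - by rewrite (@lt_trans _ _ 0)// ?oppr_lt0 ltr0n.
  - exact: continuous_subspaceT.
  - split=> [x _||]; first exact: dF.
    + by apply: cvg_at_right_filter; exact: cF.
    + by apply: cvg_at_left_filter; exact: cF.
  - by [].
have lim1 : (\int[mu]_x (((derive1 F) \_ (A n)) x)%:E @[n --> \oo] -->
    \int[mu]_x (derive1 F x)%:E)%E.
  apply: (@dominated_cvg _ _ _ mu setT measurableT
    (fun n x => (((derive1 F) \_ (A n)) x)%:E) _ (EFin \o (Num.norm \o derive1 F))).
  - move=> n; apply/measurable_EFinP.
    apply/(measurable_restrictT _ _).1; first exact: measurable_itv.
    by apply: measurable_funTS; exact: continuous_measurable_fun.
  - move=> x _; apply: cvg_near_cst.
    near=> n; rewrite patchE mem_set// /A/= in_itv/= -ler_norml.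
    by near: n; exact: nbhs_infty_ger.
  - by [].
  - exact: (integrable_norm intF').
  - move=> n x _; rewrite /= lee_fin patchE; case: ifP => // _.
    by rewrite normr0.
have lim2 : ((F n%:R - F (- n%:R))%:E @[n --> \oo] --> (0:R)%:E)%E.
  apply: cvg_EFin; first exact: nearW.
  have C0 : 0 <= C.
    by have := FC 0; rewrite expr0n addr0 divr1; apply: le_trans.
  have b0 : (2 * C * n.+1%:R^-1) @[n --> \oo] --> (0:R).
    rewrite -(mulr0 (2 * C)); apply: cvgM; first exact: cvg_cst.
    exact: cvg_harmonic.
  apply: norm_cvg0.
  apply: (@squeeze_cvgr _ _ _ _ (cst 0) _ _ _ _ _ b0); last exact: cvg_cst.
  apply: nearW => n /=; rewrite normr_ge0/=.
  have Vn : (1 + n%:R ^+ 2)^-1 <= n.+1%:R^-1 :> R.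
    rewrite lef_pV2 ?posrE ?ltr0n ?ltr_wpDr ?sqr_ge0//.
    rewrite -nat1r lerD2l -natrX ler_nat.
    by case: (n) => // k; rewrite expnS expn1 leq_pmulr.
  have h1 := FC n%:R; have h2 := FC (- n%:R).
  rewrite sqrrN in h2.
  apply: le_trans (ler_normB _ _) _.
  apply: le_trans (lerD h1 h2) _.
  rewrite -mulrA mulr_natl mulr2n.
  exact: lerD (ler_wpM2l C0 Vn) (ler_wpM2l C0 Vn).
have : (\int[mu]_x (derive1 F x)%:E)%E = 0%:E.
  have : {near \oo, (fun n => (F n%:R - F (- n%:R))%:E) =1
      (fun n => (\int[mu]_x ((derive1 F \_ (A n)) x)%:E)%E)}.
    near=> n; rewrite -FTC; last by near: n; exact: nbhs_infty_gt.
    by rewrite [LHS]integral_mkcond; apply: eq_integral => x _; rewrite restrict_EFin.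
  move/near_eq_cvg/cvg_trans => /(_ _ lim2) lim1'.
  exact: (cvg_unique _ lim1 lim1').
by rewrite /Rintegral => ->.
Unshelve. all: by end_near. Qed.

End Decay.

(** * Schwartz functions and the commutators of the oscillator *)

Section Schwartz.
Context {R : realType}.
Local Notation mu := (@lebesgue_measure R).
Implicit Types (phi psi : R -> R) (c : R).

Definition mulX phi : R -> R := fun x => x * phi x.

Lemma derive1D phi psi : (forall x, derivable phi x 1) ->
  (forall x, derivable psi x 1) -> derive1 (phi + psi) = derive1 phi + derive1 psi.
Proof.
move=> dphi dpsi; apply/funext => x.
rewrite derive1E deriveD; [|exact: dphi|exact: dpsi].
by rewrite -!derive1E.
Qed.

Lemma derive1Z c phi : (forall x, derivable phi x 1) ->
  derive1 (c *: phi) = c *: derive1 phi.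
Proof.
move=> dphi; apply/funext => x.
by rewrite derive1E deriveZ; [rewrite -derive1E|exact: dphi].
Qed.

Lemma derivable_mulX phi x : derivable phi x 1 -> derivable (mulX phi) x 1.
Proof.
by move=> dphi; apply: (@derivableM _ _ id phi); [exact: derivable_id|exact: dphi].
Qed.

Lemma derive1_mulX phi : (forall x, derivable phi x 1) ->
  derive1 (mulX phi) = phi + mulX (derive1 phi).
Proof.
move=> dphi; apply/funext => x.
rewrite derive1E (@deriveM _ _ id phi); [|exact: derivable_id|exact: dphi].
by rewrite derive_id -derive1E addrC /=; congr (_ + _); exact: mulr1.
Qed.

Lemma derive1nD k phi psi : schwartz phi -> schwartz psi ->
  derive1n k (phi + psi) = derive1n k phi + derive1n k psi.
Proof.
move=> [dphi _] [dpsi _]; elim: k => [//|k IH].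
by rewrite !derive1nS IH derive1D; [|exact: dphi|exact: dpsi].
Qed.

Lemma derive1nZ k c phi : schwartz phi ->
  derive1n k (c *: phi) = c *: derive1n k phi.
Proof.
move=> [dphi _]; elim: k => [//|k IH].
by rewrite !derive1nS IH derive1Z; [|exact: dphi].
Qed.

Lemma derive1n_mulX k phi : schwartz phi ->
  derive1n k (mulX phi) = k%:R *: derive1n k.-1 phi + mulX (derive1n k phi).
Proof.
move=> [dphi _]; elim: k => [|k IH]; first by rewrite /= scale0r add0r.
have dX x : derivable (mulX (derive1n k phi)) x 1 by exact: derivable_mulX.
rewrite derive1nS IH derive1D; [|by move=> x; apply: derivableZ; exact: dphi|exact: dX].
rewrite derive1Z; last exact: dphi.
rewrite derive1_mulX; last exact: dphi.
rewrite addrA; congr (_ + _).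
case: k {IH dX} => [|k] /=; first by rewrite scale0r add0r scale1r.
by rewrite -derive1nS -[in RHS]natr1 scalerDl scale1r.
Qed.

Lemma schwartz_derivable phi x : schwartz phi -> derivable phi x 1.
Proof. by case=> /(_ 0%N). Qed.

Lemma schwartz_continuous phi : schwartz phi -> continuous phi.
Proof.
move=> sphi x; apply/differentiable_continuous/derivable1_diffP.
exact: schwartz_derivable.
Qed.

Lemma schwartz_bounded phi : schwartz phi ->
  exists C : R, 0 <= C /\ forall x, `|phi x| <= C.
Proof.
case=> _ /(_ 0%N 0%N)[C hC]; exists C; split=> [|x].
  by apply: le_trans (hC 0).
by have := hC x; rewrite expr0 mul1r.
Qed.

Lemma schwartz_derive1 phi : schwartz phi -> schwartz (derive1 phi).
Proof.
case=> dphi bphi; split=> [k x|j k].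
  by rewrite -derive1Sn; exact: dphi.
by have [C hC] := bphi j k.+1; exists C => x; rewrite -derive1Sn; exact: hC.
Qed.

Lemma schwartzD phi psi : schwartz phi -> schwartz psi -> schwartz (phi + psi).
Proof.
move=> sphi spsi; split=> [k x|j k]; rewrite derive1nD//.
  by apply: derivableD; [case: sphi|case: spsi].
have [[_ /(_ j k)[C hC]] [_ /(_ j k)[D hD]]] := (sphi, spsi).
exists (C + D) => x; rewrite mulrDr; apply: le_trans (ler_normD _ _) _.
exact: lerD.
Qed.

Lemma schwartzZ c phi : schwartz phi -> schwartz (c *: phi).
Proof.
move=> sphi; split=> [k x|j k]; rewrite derive1nZ//.
  by apply: derivableZ; case: sphi.
have [_ /(_ j k)[C hC]] := sphi.
exists (`|c| * C) => x.
rewrite [X in `|_ * X|](_ : _ = c * derive1n k phi x)// mulrCA normrM.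
by rewrite ler_wpM2l.
Qed.

Lemma schwartz_mulX phi : schwartz phi -> schwartz (mulX phi).
Proof.
move=> sphi; have [dphi bphi] := sphi; split=> [k x|j k]; rewrite derive1n_mulX//.
  by apply: derivableD; [apply: derivableZ|apply: derivable_mulX]; exact: dphi.
have [C hC] := bphi j k.-1; have [D hD] := bphi j.+1 k.
exists (k%:R * C + D) => x.
rewrite [X in `|_ * X|](_ : _ = k%:R * derive1n k.-1 phi x + x * derive1n k phi x)//.
rewrite mulrDr mulrCA (mulrA (x ^+ j) x) -exprSr.
apply: le_trans (ler_normD _ _) _; apply: lerD => //.
by rewrite normrM normr_nat ler_wpM2l.
Qed.

Lemma schwartzN phi : schwartz phi -> schwartz (- phi).
Proof. by move=> /(schwartzZ (-1)); rewrite scaleN1r. Qed.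

Lemma schwartz0 : schwartz (0 : R -> R).
Proof.
have d0 k : derive1n k (0 : R -> R) = 0.
  by elim: k => // k IH; rewrite derive1nS IH; apply/funext => x; rewrite derive1_cst.
split=> [k x|j k]; first by rewrite d0; exact: derivable_cst.
by exists 0 => x; rewrite d0 mulr0 normr0.
Qed.

Lemma oscillatorE phi : oscillator phi =
  2^-1 *: (- derive1 (derive1 phi) + mulX (mulX phi) + phi).
Proof. by apply/funext => x; rewrite /oscillator /mulX expr2 -mulrA. Qed.

Lemma schwartz_oscillator phi : schwartz phi -> schwartz (oscillator phi).
Proof.
move=> sphi; rewrite oscillatorE; apply/schwartzZ/schwartzD => //.
apply: schwartzD; last by do 2 apply: schwartz_mulX.
by apply/schwartzN; do 2 apply: schwartz_derive1.
Qed.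

Lemma oscillatorD phi psi : schwartz phi -> schwartz psi ->
  oscillator (phi + psi) = oscillator phi + oscillator psi.
Proof.
move=> sphi spsi; apply/funext => x; rewrite /oscillator derive1nD//.
rewrite -[(phi + psi) x]/(phi x + psi x).
rewrite -[(derive1n 2 phi + derive1n 2 psi) x]/(derive1n 2 phi x + derive1n 2 psi x).
rewrite -[RHS]/(oscillator phi x + oscillator psi x) /oscillator.
move: (derive1n 2 phi x) (derive1n 2 psi x) (phi x) (psi x) => a b u v.
by ring.
Qed.

Lemma oscillatorZ c phi : schwartz phi -> oscillator (c *: phi) = c *: oscillator phi.
Proof.
move=> sphi; apply/funext => x; rewrite /oscillator derive1nZ//.
rewrite -[(c *: phi) x]/(c * phi x).
rewrite -[(c *: derive1n 2 phi) x]/(c * derive1n 2 phi x).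
rewrite -[RHS]/(c * oscillator phi x) /oscillator.
move: (derive1n 2 phi x) (phi x) => a u.
by ring.
Qed.

(** Commuting the oscillator past derivation leaves multiplication by [x], and
conversely in the next lemma: both remainders are of lower order, which is what
makes inductions on powers of the oscillator close. *)
Lemma oscillator_derive1 phi : schwartz phi ->
  oscillator (derive1 phi) = derive1 (oscillator phi) - mulX phi.
Proof.
move=> sphi; have sphi' := schwartz_derive1 sphi.
have sphi'' := schwartz_derive1 sphi'.
have sX := schwartz_mulX sphi; have sXX := schwartz_mulX sX.
rewrite (oscillatorE phi) derive1Z; last first.
  move=> x; apply/schwartz_derivable/schwartzD => //; apply: schwartzD => //.
  exact: schwartzN.
rewrite derive1D; last 2 first.
- by move=> x; apply/schwartz_derivable/schwartzD => //; exact: schwartzN.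
- by move=> x; exact: schwartz_derivable.
rewrite derive1D; last 2 first.
- by move=> x; apply/schwartz_derivable/schwartzN.
- by move=> x; exact: schwartz_derivable.
rewrite -scaleN1r derive1Z; last by move=> x; exact: schwartz_derivable.
rewrite derive1_mulX; last by move=> x; exact: schwartz_derivable.
rewrite derive1_mulX; last by move=> x; exact: schwartz_derivable.
apply/funext => x; rewrite /oscillator /mulX ?fctE /GRing.scale/=.
move: (derive1 (derive1 (derive1 phi)) x) (derive1 phi x) (phi x) => a b u.
by field.
Qed.

Lemma oscillator_mulX phi : schwartz phi ->
  oscillator (mulX phi) = mulX (oscillator phi) - derive1 phi.
Proof.
move=> sphi; have sphi' := schwartz_derive1 sphi.
apply/funext => x; rewrite /oscillator derive1n_mulX//.
rewrite /mulX ?fctE /GRing.scale/=.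
move: (derive1 (derive1 phi) x) (derive1 phi x) (phi x) => a b u.
by field.
Qed.

End Schwartz.

(** * The L2 inner product and the oscillator norms *)

Section InnerProduct.
Context {R : realType}.
Local Notation mu := (@lebesgue_measure R).
Implicit Types (phi psi chi : R -> R) (c : R).

Lemma schwartzM_decays phi psi : schwartz phi -> schwartz psi ->
  decays (phi * psi).
Proof.
move=> sphi spsi; have [D [D0 hD]] := schwartz_bounded sphi.
have [_ bpsi] := spsi; have [C0 hC0] := bpsi 0%N 0%N; have [C2 hC2] := bpsi 2%N 0%N.
exists (D * (C0 + C2)) => x.
have x0 : 0 < 1 + x ^+ 2 by rewrite ltr_pwDl ?ltr01 ?sqr_ge0.
rewrite ler_pdivlMr// -[(phi * psi) x]/(phi x * psi x) normrM -mulrA.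
have -> : `|psi x| * (1 + x ^+ 2) = `|x ^+ 0 * psi x| + `|x ^+ 2 * psi x|.
  by rewrite expr0 mul1r normrM (ger0_norm (sqr_ge0 x)) mulrDr mulr1 (mulrC (x ^+ 2)).
by apply: ler_pM; rewrite ?addr_ge0//; apply: lerD; [exact: hC0|exact: hC2].
Qed.

Lemma continuousM_fun phi psi : continuous phi -> continuous psi ->
  continuous (phi * psi).
Proof. by move=> cphi cpsi x; apply: cvgM; [exact: cphi|exact: cpsi]. Qed.

Lemma schwartzM_integrable phi psi : schwartz phi -> schwartz psi ->
  mu.-integrable setT (EFin \o (fun x => phi x * psi x)).
Proof.
move=> sphi spsi; apply: (@decays_integrable _ (phi * psi)).
  by apply: continuousM_fun; exact: schwartz_continuous.
exact: schwartzM_decays.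
Qed.

Definition ip phi psi : R := \int[mu]_x (phi x * psi x).

Lemma ipC phi psi : ip phi psi = ip psi phi.
Proof. by apply: eq_Rintegral => x _; rewrite mulrC. Qed.

Lemma ipDl phi psi chi : schwartz phi -> schwartz psi -> schwartz chi ->
  ip (phi + psi) chi = ip phi chi + ip psi chi.
Proof.
move=> sphi spsi schi; rewrite /ip -RintegralD//; last 2 first.
- exact: schwartzM_integrable.
- exact: schwartzM_integrable.
by apply: eq_Rintegral => x _; rewrite -mulrDl.
Qed.

Lemma ipZl c phi chi : schwartz phi -> schwartz chi ->
  ip (c *: phi) chi = c * ip phi chi.
Proof.
move=> sphi schi; rewrite /ip -RintegralZl//; last exact: schwartzM_integrable.
by apply: eq_Rintegral => x _; rewrite mulrA.
Qed.

Lemma ipDr phi psi chi : schwartz phi -> schwartz psi -> schwartz chi ->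
  ip chi (phi + psi) = ip chi phi + ip chi psi.
Proof. by move=> *; rewrite ipC ipDl// !(ipC _ chi). Qed.

Lemma ipZr c phi chi : schwartz phi -> schwartz chi ->
  ip chi (c *: phi) = c * ip chi phi.
Proof. by move=> *; rewrite ipC ipZl// (ipC _ chi). Qed.

Lemma ip_ge0 phi : 0 <= ip phi phi.
Proof. by apply: Rintegral_ge0 => x _; rewrite -expr2 sqr_ge0. Qed.

Lemma ip_mulX phi psi : ip (mulX phi) psi = ip phi (mulX psi).
Proof. by apply: eq_Rintegral => x _; rewrite /mulX mulrCA mulrA. Qed.

Lemma ip_derive1 phi psi : schwartz phi -> schwartz psi ->
  ip (derive1 phi) psi = - ip phi (derive1 psi).
Proof.
move=> sphi spsi; apply/eqP; rewrite -addr_eq0; apply/eqP.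
have sphi' := schwartz_derive1 sphi; have spsi' := schwartz_derive1 spsi.
have dF x : derivable (phi * psi) x 1.
  by apply: derivableM; exact: schwartz_derivable.
have F'E : derive1 (phi * psi) = derive1 phi * psi + phi * derive1 psi.
  apply/funext => x; rewrite derive1E deriveM; try exact: schwartz_derivable.
  rewrite -!derive1E addrC; congr (_ + _); exact: mulrC.
transitivity (\int[mu]_x derive1 (phi * psi) x).
  by rewrite F'E /ip -RintegralD//; exact: schwartzM_integrable.
apply: Rintegral_derive1_eq0.
- exact: dF.
- rewrite F'E => x; apply: cvgD; apply: continuousM_fun; exact: schwartz_continuous.
- exact: schwartzM_decays.
- rewrite F'E.
  have [C hC] := schwartzM_decays sphi' spsi.
  have [D hD] := schwartzM_decays sphi spsi'.
  exists (C + D) => x; rewrite mulrDl; apply: le_trans (ler_normD _ _) _.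
  exact: lerD.
Qed.

(** The energy identity: integrating [- phi'' * phi] by parts. *)
Lemma ip_oscillator phi : schwartz phi ->
  2 * ip (oscillator phi) phi =
  ip (derive1 phi) (derive1 phi) + ip (mulX phi) (mulX phi) + ip phi phi.
Proof.
move=> sphi; have sphi' := schwartz_derive1 sphi.
have sphi'' := schwartz_derive1 sphi'.
have sX := schwartz_mulX sphi; have sXX := schwartz_mulX sX.
have sN : schwartz (- derive1 (derive1 phi)) by exact: schwartzN.
have sS : schwartz (- derive1 (derive1 phi) + mulX (mulX phi)) by exact: schwartzD.
rewrite oscillatorE ipZl//; last exact: schwartzD.
rewrite ipDl// ipDl// -scaleN1r ipZl// (ip_derive1 sphi' sphi) (ip_mulX (mulX phi)).
lra.
Qed.

(** The expansion of the squared norm of [a *: phi - b *: psi]; it stands in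
for the Cauchy-Schwarz inequality, with [a] and [b] chosen at each use. *)
Lemma ip_sqrB a b phi psi : schwartz phi -> schwartz psi ->
  0 <= a ^+ 2 * ip phi phi + b ^+ 2 * ip psi psi - (2 * a * b) * ip phi psi.
Proof.
move=> sphi spsi; have sa := schwartzZ a sphi; have sb := schwartzZ (- b) spsi.
have := ip_ge0 (a *: phi + (- b) *: psi).
rewrite ipDl//; last exact: schwartzD.
rewrite !ipDr// !ipZl// !ipZr// (ipC psi phi).
by congr (0 <= _); ring.
Qed.

(** In the energy identity, [2 * ip (oscillator phi) phi] is at most
[ip (oscillator phi) (oscillator phi) + ip phi phi], and the last term
cancels. *)
Lemma ip_derive1_mulX_le phi : schwartz phi ->
  ip (derive1 phi) (derive1 phi) + ip (mulX phi) (mulX phi) <=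
  ip (oscillator phi) (oscillator phi).
Proof.
move=> sphi; have := ip_sqrB 1 1 (schwartz_oscillator sphi) sphi.
have := ip_oscillator sphi; lra.
Qed.

Lemma ip_le_oscillator phi : schwartz phi ->
  ip phi phi <= 4 * ip (oscillator phi) (oscillator phi).
Proof.
move=> sphi; have := ip_sqrB 2 1 (schwartz_oscillator sphi) sphi.
have := ip_oscillator sphi.
have := ip_ge0 (derive1 phi); have := ip_ge0 (mulX phi); lra.
Qed.

End InnerProduct.

Section Norms.
Context {R : realType}.
Implicit Types (phi psi chi : R -> R) (c : R) (m : nat).

Lemma snormE m phi :
  snorm m phi = Num.sqrt (ip (iter m oscillator phi) (iter m oscillator phi)).
Proof.
congr Num.sqrt; apply: eq_Rintegral => x _.
by rewrite -normrX ger0_norm ?sqr_ge0// expr2.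
Qed.

Lemma snorm_ge0 m phi : 0 <= snorm m phi.
Proof. exact: sqrtr_ge0. Qed.

Lemma snormS m phi : snorm m.+1 phi = snorm m (oscillator phi).
Proof. by rewrite /snorm iterSr. Qed.

Lemma schwartz_iter m phi : schwartz phi -> schwartz (iter m oscillator phi).
Proof. by move=> sphi; elim: m => //= m; exact: schwartz_oscillator. Qed.

Lemma iter_oscillatorD m phi psi : schwartz phi -> schwartz psi ->
  iter m oscillator (phi + psi) = iter m oscillator phi + iter m oscillator psi.
Proof.
move=> sphi spsi; elim: m => //= m ->.
by rewrite oscillatorD//; exact: schwartz_iter.
Qed.

Lemma iter_oscillatorZ m c phi : schwartz phi ->
  iter m oscillator (c *: phi) = c *: iter m oscillator phi.
Proof.
by move=> sphi; elim: m => //= m ->; rewrite oscillatorZ//; exact: schwartz_iter.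
Qed.

Lemma snormZ m c phi : schwartz phi -> snorm m (c *: phi) = `|c| * snorm m phi.
Proof.
move=> sphi; have si := schwartz_iter m sphi.
rewrite !snormE iter_oscillatorZ// ipZl ?ipZr//; last exact: schwartzZ.
by rewrite mulrA -expr2 sqrtrM ?sqr_ge0// sqrtr_sqr.
Qed.

(** The factor 2 comes from [(a + b) ^+ 2 <= 2 * a ^+ 2 + 2 * b ^+ 2].  Only
growth rates of norms matter in the sequel, so constants are not optimized. *)
Lemma snormD m phi psi : schwartz phi -> schwartz psi ->
  snorm m (phi + psi) <= 2 * (snorm m phi + snorm m psi).
Proof.
move=> sphi spsi; have si := schwartz_iter m sphi; have sj := schwartz_iter m spsi.
rewrite !snormE iter_oscillatorD//.
move: (iter m _ phi) (iter m _ psi) si sj => f g sf sg {phi psi sphi spsi}.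
have s0 := sqrtr_ge0 (ip f f); have t0 := sqrtr_ge0 (ip g g).
rewrite -[leRHS]ger0_norm; last by rewrite mulr_ge0// addr_ge0.
rewrite -sqrtr_sqr ler_sqrt ?sqr_ge0//.
rewrite ipDl//; last exact: schwartzD.
rewrite !ipDr// (ipC g f).
have := ip_sqrB 1 1 sf sg.
have := sqr_sqrtr (ip_ge0 f); have := sqr_sqrtr (ip_ge0 g).
have := mulr_ge0 s0 t0.
move: (Num.sqrt _) (Num.sqrt _) => s t.
have -> : (2 * (t + s)) ^+ 2 = 4 * t ^+ 2 + 4 * s ^+ 2 + 8 * (t * s) by ring.
have := ip_ge0 f; have := ip_ge0 g.
lra.
Qed.

Lemma ler_sqrt_mul c (a b : R) : 0 <= c -> a <= c ^+ 2 * b ->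
  Num.sqrt a <= c * Num.sqrt b.
Proof.
move=> c0 ab; rewrite -{1}(ger0_norm c0) -sqrtr_sqr -sqrtrM ?sqr_ge0//.
exact: ler_wsqrtr.
Qed.

Lemma snorm_leS m phi : schwartz phi -> snorm m phi <= 2 * snorm m.+1 phi.
Proof.
move=> sphi; rewrite !snormE; apply: ler_sqrt_mul => //.
by rewrite (_ : 2 ^+ 2 = 4)//; [exact/ip_le_oscillator/schwartz_iter|ring].
Qed.

(** Lets bounds that lose different numbers of derivatives be added. *)
Lemma snorm_leD m k phi : schwartz phi -> snorm m phi <= 2 ^+ k * snorm (m + k) phi.
Proof.
move=> sphi; elim: k => [|k IH]; first by rewrite expr0 mul1r addn0.
apply: le_trans IH _; rewrite exprSr -mulrA ler_wpM2l ?exprn_ge0// addnS.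
exact: snorm_leS.
Qed.

(** Derivation and multiplication by [x] have to be bounded together: commuting
one of them past an oscillator produces the other.  The base case is the energy
estimate. *)
Lemma snorm_derive1_mulX m : exists C : R, 0 <= C /\ forall phi, schwartz phi ->
  snorm m (derive1 phi) <= C * snorm m.+1 phi /\
  snorm m (mulX phi) <= C * snorm m.+1 phi.
Proof.
elim: m => [|m [C [C0 IH]]].
  exists 1; split=> // phi sphi; rewrite !snormE/=.
  have := ip_derive1_mulX_le sphi.
  have := ip_ge0 (derive1 phi); have := ip_ge0 (mulX phi) => h1 h2 h3.
  by split; apply: ler_sqrt_mul => //; rewrite expr1n mul1r; lra.
have key (a b c d : R) : a <= C * d -> b <= C * c -> C * c <= C * (2 * d) ->
    2 * (a + b) <= 2 * (C + C * 2) * d by lra.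
exists (2 * (C + C * 2)); split=> [|phi sphi].
  by rewrite mulr_ge0// addr_ge0// mulr_ge0.
have sA := schwartz_oscillator sphi.
have [h1 h2] := IH _ sA; have [h3 h4] := IH _ sphi.
have h5 := ler_wpM2l C0 (snorm_leS m.+1 sphi).
rewrite !snormS in h1 h2 h3 h4 h5 *.
have sN psi : schwartz psi -> snorm m (- psi) = snorm m psi.
  by move=> spsi; rewrite -scaleN1r snormZ// normrN1 mul1r.
rewrite (oscillator_derive1 sphi) (oscillator_mulX sphi).
have sX := schwartz_mulX sphi; have sd := schwartz_derive1 sphi.
have := snormD m (schwartz_derive1 sA) (schwartzN sX).
have := snormD m (schwartz_mulX sA) (schwartzN sd).
rewrite (sN _ sX) (sN _ sd) => h6 h7.
split; first exact: le_trans h7 (key _ _ _ _ h1 h4 h5).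
exact: le_trans h6 (key _ _ _ _ h2 h3 h5).
Qed.

(** Operators bounded for the norms [snorm], with constants uniform in the
parameter; the index [k] may depend on [m], which corresponds to a loss of
derivatives. *)
Definition tempered_family (D : set R) (L : R -> (R -> R) -> R -> R) :=
  (forall t phi, D t -> schwartz phi -> schwartz (L t phi)) /\
  forall m, exists (C : R) k, 0 <= C /\ forall t phi, D t -> schwartz phi ->
    snorm m (L t phi) <= C * snorm k phi.

Lemma tempered_id D : tempered_family D (fun=> id).
Proof. by split=> // m; exists 1, m; split=> // t phi _ _; rewrite mul1r. Qed.

Lemma tempered_derive1 D : tempered_family D (fun _ phi => derive1 phi).
Proof.
split=> [t phi _|m]; first exact: schwartz_derive1.
have [C [C0 hC]] := snorm_derive1_mulX m; exists C, m.+1; split=> // t phi _ sphi.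
by case: (hC _ sphi).
Qed.

Lemma tempered_mulX D : tempered_family D (fun=> mulX).
Proof.
split=> [t phi _|m]; first exact: schwartz_mulX.
have [C [C0 hC]] := snorm_derive1_mulX m; exists C, m.+1; split=> // t phi _ sphi.
by case: (hC _ sphi).
Qed.

Lemma tempered_comp D L K : tempered_family D L -> tempered_family D K ->
  tempered_family D (fun t phi => L t (K t phi)).
Proof.
move=> [sL bL] [sK bK]; split=> [t phi Dt sphi|m]; first exact/sL/sK.
have [C [k [C0 hC]]] := bL m; have [C' [k' [C'0 hC']]] := bK k.
exists (C * C'), k'; split=> [|t phi Dt sphi]; first exact: mulr_ge0.
apply: le_trans (hC t _ Dt (sK t _ Dt sphi)) _.
by rewrite -mulrA ler_wpM2l//; exact: hC'.
Qed.

Lemma tempered_add D L K : tempered_family D L -> tempered_family D K ->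
  tempered_family D (fun t phi => L t phi + K t phi).
Proof.
move=> [sL bL] [sK bK]; split=> [t phi Dt sphi|m].
  by apply: schwartzD; [exact: sL|exact: sK].
have [C [k [C0 hC]]] := bL m; have [C' [k' [C'0 hC']]] := bK m.
exists (2 * (C * 2 ^+ k' + C' * 2 ^+ k)), (k + k')%N; split=> [|t phi Dt sphi].
  by rewrite mulr_ge0// addr_ge0// mulr_ge0// exprn_ge0.
apply: le_trans (snormD m (sL _ _ Dt sphi) (sK _ _ Dt sphi)) _.
rewrite -mulrA ler_wpM2l// mulrDl; apply: lerD.
  apply: le_trans (hC _ _ Dt sphi) _; rewrite -mulrA ler_wpM2l//.
  exact: snorm_leD.
apply: le_trans (hC' _ _ Dt sphi) _; rewrite -mulrA ler_wpM2l// addnC.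
exact: snorm_leD.
Qed.

Lemma tempered_scale (D : set R) (c : R -> R) M L : (forall t, D t -> `|c t| <= M) ->
  tempered_family D L -> tempered_family D (fun t phi => c t *: L t phi).
Proof.
move=> cM [sL bL]; split=> [t phi Dt sphi|m]; first exact/schwartzZ/sL.
have [C [k [C0 hC]]] := bL m; exists (`|M| * C), k; split=> [|t phi Dt sphi].
  exact: mulr_ge0.
rewrite snormZ; last exact: sL.
rewrite -mulrA ler_pM ?snorm_ge0 ?normr_ge0//; last exact: hC.
by apply: le_trans (cM _ Dt) _; exact: ler_norm.
Qed.

Lemma tempered_iter D L m : tempered_family D L ->
  tempered_family D (fun t => iter m (L t)).
Proof.
by move=> tL; elim: m => [|m IH]; [exact: tempered_id|exact: (tempered_comp tL IH)].
Qed.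

End Norms.

(** * The standard Gaussian density *)

Section Gaussian.
Context {R : realType}.
Local Notation mu := (@lebesgue_measure R).
Implicit Types (phi psi h : R -> R) (c : R).

Definition gauss : R -> R := normal_pdf 0 1.

Lemma gauss_ge0 y : 0 <= gauss y.
Proof. exact: normal_pdf_ge0. Qed.

Lemma gaussE : gauss = normal_peak 1 *: (expR \o (fun y => - (2^-1 * y ^+ 2))).
Proof.
apply/funext => y; rewrite /gauss normal_pdfE ?oner_neq0// /normal_fun.
congr (_ * expR _); rewrite subr0 expr1n -[1 *+ 2]/(2%:R) mulNr mulrC.
by [].
Qed.

Lemma is_derive_affine (a b x : R) :
  is_derive x 1 (fun x : R => a + x * b) b.
Proof.
have -> : (fun x : R => a + x * b) = cst a + b *: id.
  by apply/funext => y; rewrite mulrC.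
apply: (is_derive_eq (is_deriveD (is_derive_cst a x 1)
  (is_deriveZ b (is_derive_id x (1 : R))))).
by rewrite add0r; exact: mulr1.
Qed.

Lemma derivable_affine (a b x : R) : derivable (fun x : R => a + x * b) x 1.
Proof. by have [] := is_derive_affine a b x. Qed.

Lemma derive1_affine (a b x : R) : derive1 (fun x : R => a + x * b) x = b.
Proof. by rewrite derive1E; have [] := is_derive_affine a b x. Qed.

Lemma derivable1_comp (f g : R -> R) x : derivable f x 1 ->
  derivable g (f x) 1 -> derivable (g \o f) x 1.
Proof.
move=> /derivable1_diffP df /derivable1_diffP dg.
by apply/derivable1_diffP; exact: differentiable_comp.
Qed.

Lemma is_derive_gauss (y : R) : is_derive y 1 gauss (- (y * gauss y)).
Proof.
pose q : R -> R := - 2^-1 *: (id * id).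
have dq : is_derive y 1 q (- y).
  apply: (is_derive_eq (is_deriveZ _
    (is_deriveM (is_derive_id y (1 : R)) (is_derive_id y (1 : R))))).
  rewrite -[LHS]/(- 2^-1 * (y * 1 + y * 1)).
  by field.
have gE : gauss = normal_peak 1 *: (expR \o q).
  rewrite gaussE; congr (_ *: _); apply/funext => z /=; congr expR.
  by rewrite -[RHS]/(- 2^-1 * (z * z)) mulNr expr2.
have dexp : derivable expR (q y) 1 by exact: derivable_expR.
have dqy : derivable q y 1 by case: dq.
have deq : derivable (expR \o q) y 1 by exact: derivable1_comp.
apply: DeriveDef; first by rewrite gE; apply: derivableZ; exact: deq.
rewrite gE deriveZ; last exact: deq.
rewrite -derive1E derive1_comp; [|exact: dqy|exact: dexp].
rewrite (derive1E q) (@derive_val _ _ _ _ _ _ _ dq) derive1E.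
rewrite (@derive_val _ _ _ _ _ _ _ (is_derive_expR (q y))).
rewrite -[LHS]/(normal_peak 1 * (expR (q y) * - y)).
rewrite -[RHS]/(- (y * (normal_peak 1 * expR (q y)))).
by move: (expR _) (normal_peak 1) => e c; ring.
Qed.

Lemma derivable_gauss (y : R) : derivable gauss y 1.
Proof. by have [] := is_derive_gauss y. Qed.

Lemma derive1_gauss (y : R) : derive1 gauss y = - (y * gauss y).
Proof. by rewrite derive1E; have [] := is_derive_gauss y. Qed.

Lemma continuous_gauss : continuous gauss.
Proof. by apply: continuous_normal_pdf; rewrite oner_neq0. Qed.

(** The square of [1 + u <= expR u] at [u = y ^+ 2 / 4] bounds
[expR (y ^+ 2 / 2)] from below by a multiple of [(1 + y ^+ 2) ^+ 2]. *)
Lemma gauss_decay : exists K : R, 0 <= K /\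
  forall y, gauss y <= K / (1 + y ^+ 2) ^+ 2.
Proof.
exists (normal_peak 1 * 16); split=> [|y]; first by rewrite mulr_ge0// normal_peak_ge0.
have y0 : 0 < 1 + y ^+ 2 by rewrite ltr_pwDl ?ltr01 ?sqr_ge0.
rewrite ler_pdivlMr ?exprn_gt0// gaussE.
rewrite -[X in X * _]/(normal_peak 1 * expR (- (2^-1 * y ^+ 2))).
rewrite -mulrA ler_wpM2l ?normal_peak_ge0//.
rewrite expRN mulrC ler_pdivrMr ?expR_gt0//.
have -> : 2^-1 * y ^+ 2 = y ^+ 2 / 4 + y ^+ 2 / 4 by field.
rewrite expRD -expr2.
have h := expR_ge1Dx (y ^+ 2 / 4).
have -> : 16 * expR (y ^+ 2 / 4) ^+ 2 = (4 * expR (y ^+ 2 / 4)) ^+ 2 :> R.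
  by rewrite exprMn; congr (_ * _); ring.
rewrite ler_pXn2r ?nnegrE ?(ltW y0)// ?mulr_ge0 ?expR_ge0//.
have := sqr_ge0 y; lra.
Qed.

Lemma decaysM_gauss C h : 0 <= C -> (forall y, `|h y| <= C * (1 + y ^+ 2)) ->
  decays (h * gauss).
Proof.
move=> C0 hC; have [K [K0 hK]] := gauss_decay.
exists (C * K) => y; have y0 : 0 < 1 + y ^+ 2 by rewrite ltr_pwDl ?ltr01 ?sqr_ge0.
rewrite -[(h * gauss) y]/(h y * gauss y) normrM (ger0_norm (gauss_ge0 y)).
apply: le_trans (ler_pM (normr_ge0 _) (gauss_ge0 y) (hC y) (hK y)) _.
rewrite le_eqVlt; apply/orP; left; apply/eqP; field.
by rewrite gt_eqF.
Qed.

Lemma integrableM_gauss C h : 0 <= C -> continuous h ->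
  (forall y, `|h y| <= C * (1 + y ^+ 2)) ->
  mu.-integrable setT (EFin \o (fun y => h y * gauss y)).
Proof.
move=> C0 ch hC; apply: (@decays_integrable _ (h * gauss)).
  by apply: continuousM_fun => //; exact: continuous_gauss.
exact: decaysM_gauss hC.
Qed.

Lemma le_oneDsqr (y : R) : 1 <= 1 + y ^+ 2. Proof. by rewrite lerDl sqr_ge0. Qed.

Lemma le_norm_oneDsqr (y : R) : `|y| <= 1 + y ^+ 2.
Proof.
rewrite -[y ^+ 2]ger0_norm ?sqr_ge0// normrX; move: `|y| => a.
by have := sqr_ge0 (a - 2^-1); rewrite sqrrB; lra.
Qed.

Lemma integrable_bounded_gauss C h : continuous h -> (forall y, `|h y| <= C) ->
  mu.-integrable setT (EFin \o (fun y => h y * gauss y)).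
Proof.
move=> ch hC; have C0 : 0 <= C by apply: le_trans (hC 0).
apply: (@integrableM_gauss C) => // y; apply: le_trans (hC y) _.
by rewrite ler_peMr// le_oneDsqr.
Qed.

Lemma Rintegral_gauss : \int[mu]_y gauss y = 1.
Proof. by rewrite /Rintegral integral_normal_pdf. Qed.

(** Gaussian integration by parts (the Stein identity): the derivative of
[psi * gauss] is [derive1 psi * gauss] minus [y * psi * gauss], and it has
integral [0]. *)
Lemma gauss_ibp (C : R) psi : (forall y, derivable psi y 1) ->
  continuous (derive1 psi) -> (forall y, `|psi y| <= C) ->
  (forall y, `|derive1 psi y| <= C) ->
  \int[mu]_y (y * psi y * gauss y) = \int[mu]_y (derive1 psi y * gauss y).
Proof.
move=> dpsi cpsi' bpsi bpsi'.
have C0 : 0 <= C by apply: le_trans (bpsi 0).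
have cpsi : continuous psi.
  by move=> y; exact/differentiable_continuous/derivable1_diffP.
have cX : continuous (fun y : R => y * psi y).
  by move=> y; apply: cvgM; [exact: cvg_id|exact: cpsi].
have bX y : `|y * psi y| <= C * (1 + y ^+ 2).
  by rewrite normrM mulrC ler_pM// le_norm_oneDsqr.
have b1 h : (forall y, `|h y| <= C) -> forall y, `|h y| <= C * (1 + y ^+ 2).
  by move=> hC y; apply: le_trans (hC y) _; rewrite ler_peMr// le_oneDsqr.
have iX := integrableM_gauss C0 cX bX.
have i' := integrableM_gauss C0 cpsi' (b1 _ bpsi').
have dF y : derivable (psi * gauss) y 1.
  by apply: derivableM; [exact: dpsi|exact: derivable_gauss].
have F'E : derive1 (psi * gauss) =
    derive1 psi * gauss - (fun y => y * psi y) * gauss.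
  apply/funext => y; rewrite derive1E deriveM; [|exact: dpsi|exact: derivable_gauss].
  rewrite -!derive1E derive1_gauss.
  rewrite -[LHS]/(psi y * - (y * gauss y) + gauss y * derive1 psi y).
  rewrite -[RHS]/(derive1 psi y * gauss y - y * psi y * gauss y).
  move: (psi y) (derive1 psi y) (gauss y) => a b g.
  by ring.
apply/eqP; rewrite eq_sym -subr_eq0 -RintegralB//; apply/eqP.
transitivity (\int[mu]_y derive1 (psi * gauss) y); first by rewrite F'E.
apply: Rintegral_derive1_eq0.
- exact: dF.
- rewrite F'E => y; apply: cvgB; apply: cvgM; [exact: cpsi'| |exact: cX|];
    exact: continuous_gauss.
- exact: decaysM_gauss (b1 _ bpsi).
- rewrite F'E.
  have [A hA] := decaysM_gauss C0 (b1 _ bpsi').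
  have [B hB] := decaysM_gauss C0 bX.
  exists (A + B) => y; rewrite mulrDl; apply: le_trans (ler_normB _ _) _.
  exact: lerD.
Qed.

(** With [m] the Gaussian mean of [h], this is the positivity of the variance,
the Gaussian mean of [(h - m) ^+ 2]. *)
Lemma gauss_jensen (C : R) h : continuous h -> (forall y, `|h y| <= C) ->
  (\int[mu]_y (h y * gauss y)) ^+ 2 <= \int[mu]_y (h y ^+ 2 * gauss y).
Proof.
move=> ch hC; set m := \int[mu]_y (h y * gauss y).
have ih := integrable_bounded_gauss ch hC.
have ch2 : continuous (fun y : R => h y ^+ 2).
  by move=> y; apply: cvgM; exact: ch.
have ih2 : mu.-integrable setT (EFin \o (fun y => h y ^+ 2 * gauss y)).
  apply: (@integrable_bounded_gauss (C ^+ 2)) => // y.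
  by rewrite normrX ler_pXn2r// nnegrE// (le_trans _ (hC y)).
have ig : mu.-integrable setT (EFin \o gauss) by exact: integrable_normal_pdf.
have i1 : mu.-integrable setT (EFin \o (fun y => (2 * m) * (h y * gauss y))).
  exact: (@integrableZl _ _ _ mu setT measurableT (2 * m) _ ih).
have i2 : mu.-integrable setT (EFin \o (fun y => m ^+ 2 * gauss y)).
  exact: (@integrableZl _ _ _ mu setT measurableT (m ^+ 2) _ ig).
have : 0 <= \int[mu]_y
    ((h y ^+ 2 * gauss y - 2 * m * (h y * gauss y)) + m ^+ 2 * gauss y).
  apply: Rintegral_ge0 => y _.
  rewrite (_ : _ + _ = (h y - m) ^+ 2 * gauss y).
    by rewrite mulr_ge0 ?sqr_ge0 ?gauss_ge0.
  by move: (h y) (gauss y) => a b; ring.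
rewrite RintegralD//; last first.
  have := @integrableB _ _ _ mu setT measurableT _ _ ih2 i1.
  by apply: eq_integrable => //.
rewrite RintegralB// !RintegralZl// Rintegral_gauss -/m.
move: (\int[mu]_y (h y ^+ 2 * gauss y)) m {i1 i2 ih ih2} => a m; lra.
Qed.

(** Differentiation under the integral sign along the affine path
[c y + a * b y].  Taking [b = 1] gives the derivative of the heat flow in
space, and [b = id] its derivative in the standard deviation. *)
Lemma derive_gauss_integral phi (b c : R -> R) (a : R) : schwartz phi ->
  continuous b -> continuous c -> (forall y, `|b y| <= 1 + y ^+ 2) ->
  let F := fun a => \int[mu]_y (phi (c y + a * b y) * gauss y) in
  derivable F a 1 /\
  derive1 F a = \int[mu]_y (b y * derive1 phi (c y + a * b y) * gauss y).
Proof.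
move=> sphi cb cc bb F; have sphi' := schwartz_derive1 sphi.
have [C [C0 hC]] := schwartz_bounded sphi.
have [D [D0 hD]] := schwartz_bounded sphi'.
pose f a y := phi (c y + a * b y) * gauss y.
have caff z : continuous (fun y : R => c y + z * b y).
  move=> y; apply: cvgD; first exact: cc.
  by apply: cvgM; [exact: cvg_cst|exact: cb].
have cphi z : continuous (fun y : R => phi (c y + z * b y)).
  move=> y; apply: continuous_comp; first exact: caff.
  exact: (schwartz_continuous sphi).
have intf z : mu.-integrable setT (EFin \o f z).
  by apply: (@integrable_bounded_gauss C); [exact: cphi|move=> y; exact: hC].
have dphi z y : derivable (fun z : R => phi (c y + z * b y)) z 1.
  apply: (@derivable1_comp (fun z : R => c y + z * b y) phi); first exact: derivable_affine.
  exact: schwartz_derivable.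
have derf z y : derivable (f ^~ y) z 1.
  apply: (@derivableM _ _ (fun z : R => phi (c y + z * b y)) (cst (gauss y))).
    exact: dphi.
  exact: derivable_cst.
have d1f z y : partial1of2 f z y = b y * derive1 phi (c y + z * b y) * gauss y.
  rewrite /partial1of2 derive1E.
  rewrite (@deriveM _ _ (fun z : R => phi (c y + z * b y)) (cst (gauss y))); last 2 first.
  - exact: dphi.
  - exact: derivable_cst.
  rewrite derive_cst scaler0 add0r -derive1E.
  rewrite (@derive1_comp _ (fun z : R => c y + z * b y) phi); last 2 first.
  - exact: derivable_affine.
  - exact: schwartz_derivable.
  rewrite derive1_affine -[LHS]/(gauss y * (derive1 phi (c y + z * b y) * b y)).
  by rewrite mulrC (mulrC (b y)).
pose G y := D * (1 + y ^+ 2) * gauss y.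
have intG : mu.-integrable setT (EFin \o G).
  apply: (@integrableM_gauss D (fun y => D * (1 + y ^+ 2))) => //.
    move=> y; apply: cvgM; first exact: cvg_cst.
    by apply: cvgD; [exact: cvg_cst|exact: exprn_continuous].
  by move=> y; rewrite ger0_norm// mulr_ge0// (le_trans _ (le_oneDsqr y)).
have G0 y : 0 <= G y.
  by rewrite mulr_ge0 ?gauss_ge0// mulr_ge0// (le_trans _ (le_oneDsqr y)).
have Gub z y : `|partial1of2 f z y| <= G y.
  rewrite d1f normrM (ger0_norm (gauss_ge0 y)) ler_wpM2r ?gauss_ge0//.
  by rewrite normrM mulrC ler_pM.
have Ia : `]a - 1, a + 1[%classic a by rewrite /= in_itv/= ltrBlDr ltrDl ltr01.
have intf' z : `]a - 1, a + 1[%classic z -> mu.-integrable setT (EFin \o f z).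
  by move=> _; exact: intf.
have derf' z y : `]a - 1, a + 1[%classic z -> setT y -> derivable (f ^~ y) z 1.
  by move=> _ _; exact: derf.
have Gub' z y : `]a - 1, a + 1[%classic z -> setT y -> `|partial1of2 f z y| <= G y.
  by move=> _ _; exact: Gub.
split.
  exact: (@derivable_under_integral _ _ _ mu f setT measurableT a _ _
    Ia intf' derf' G G0 intG Gub').
rewrite (@differentiation_under_integral _ _ _ mu f setT measurableT a _ _
  Ia intf' derf' G G0 intG Gub').
by apply: eq_Rintegral => y _; rewrite -d1f.
Qed.

End Gaussian.

(** * The heat flow on Schwartz functions *)

Section Heat.
Context {R : realType}.
Local Notation mu := (@lebesgue_measure R).
Implicit Types (phi psi h : R -> R) (r c : R).

(** The parameter is the standard deviation [r], the square root of the time.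
The flow is differentiable in [r] everywhere, whereas the square root is not
differentiable at time [0]. *)
Definition heat r phi : R -> R := fun x => \int[mu]_y (phi (x + r * y) * gauss y).

Lemma continuous_shift r x phi : continuous phi ->
  continuous (fun y : R => phi (x + r * y)).
Proof.
move=> cphi y; apply: continuous_comp; last exact: cphi.
by apply: cvgD; [exact: cvg_cst|apply: cvgM; [exact: cvg_cst|exact: cvg_id]].
Qed.

Lemma heat_integrable r x phi : schwartz phi ->
  mu.-integrable setT (EFin \o (fun y => phi (x + r * y) * gauss y)).
Proof.
move=> sphi; have [C [_ hC]] := schwartz_bounded sphi.
apply: (@integrable_bounded_gauss _ C (fun y => phi (x + r * y))) => //.
exact/continuous_shift/schwartz_continuous.
Qed.

Lemma heatD r phi psi : schwartz phi -> schwartz psi ->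
  heat r (phi + psi) = heat r phi + heat r psi.
Proof.
move=> sphi spsi; apply/funext => x.
rewrite -[RHS]/(heat r phi x + heat r psi x) /heat -RintegralD//; last 2 first.
- exact: heat_integrable.
- exact: heat_integrable.
by apply: eq_Rintegral => y _; rewrite -mulrDl.
Qed.

Lemma heatZ r c phi : schwartz phi -> heat r (c *: phi) = c *: heat r phi.
Proof.
move=> sphi; apply/funext => x.
rewrite -[RHS]/(c * heat r phi x) /heat -RintegralZl//; last exact: heat_integrable.
by apply: eq_Rintegral => y _; rewrite mulrA.
Qed.

Lemma heat0 phi : heat 0 phi = phi.
Proof.
apply/funext => x; rewrite /heat.
under eq_Rintegral do rewrite mul0r addr0.
rewrite RintegralZl//; last exact: integrable_normal_pdf.
by rewrite Rintegral_gauss mulr1.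
Qed.

Lemma heat_bound r phi C : schwartz phi -> (forall x, `|phi x| <= C) ->
  forall x, `|heat r phi x| <= C.
Proof.
move=> sphi hC x; have iphi := heat_integrable r x sphi.
apply: le_trans (le_normr_Rintegral _ iphi) _ => //.
have -> : C = \int[mu]_y (C * gauss y).
  rewrite RintegralZl//; last exact: integrable_normal_pdf.
  by rewrite Rintegral_gauss mulr1.
apply: le_Rintegral => //.
- exact: integrable_norm iphi.
- exact: (@integrableZl _ _ _ mu setT measurableT C _ (integrable_normal_pdf 0 1)).
- by move=> y _; rewrite normrM (ger0_norm (gauss_ge0 y)) ler_wpM2r ?gauss_ge0.
Qed.

Lemma heat_derive1 r phi : schwartz phi ->
  (forall x, derivable (heat r phi) x 1) /\ derive1 (heat r phi) = heat r (derive1 phi).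
Proof.
move=> sphi.
have E : heat r phi = fun x => \int[mu]_y (phi (r * y + x * (cst 1) y) * gauss y).
  by apply/funext => x; apply: eq_Rintegral => y _; rewrite mulr1 addrC.
have c1 : continuous (cst 1 : R -> R) by move=> y; exact: cvg_cst.
have cr : continuous (fun y : R => r * y).
  by move=> y; apply: cvgM; [exact: cvg_cst|exact: cvg_id].
have b1 (y : R) : `|cst 1 y| <= 1 + y ^+ 2 :> R by rewrite normr1 le_oneDsqr.
have key x := derive_gauss_integral x sphi c1 cr b1.
split=> [x|]; first by rewrite E; case: (key x).
apply/funext => x; rewrite E; have [_ ->] := key x.
by apply: eq_Rintegral => y _; rewrite mul1r mulr1 addrC.
Qed.

Lemma heat_ibp r x phi : schwartz phi ->
  \int[mu]_y (y * phi (x + r * y) * gauss y) = r * heat r (derive1 phi) x.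
Proof.
move=> sphi; have sphi' := schwartz_derive1 sphi.
have [C [C0 hC]] := schwartz_bounded sphi.
have [D [D0 hD]] := schwartz_bounded sphi'.
pose psi y := phi (x + r * y).
have psiE : psi = phi \o (fun y => x + y * r).
  by apply/funext => y; rewrite /psi mulrC.
have dpsi y : derivable psi y 1.
  rewrite psiE; apply: derivable1_comp; first exact: derivable_affine.
  exact: schwartz_derivable.
have psi'E : derive1 psi = fun y => r * derive1 phi (x + r * y).
  apply/funext => y; rewrite psiE derive1_comp; last 2 first.
  - exact: derivable_affine.
  - exact: schwartz_derivable.
  by rewrite derive1_affine mulrC (mulrC y).
have cpsi' : continuous (derive1 psi).
  rewrite psi'E => y; apply: cvgM; first exact: cvg_cst.
  by apply: continuous_shift; exact: schwartz_continuous.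
have b1 y : `|psi y| <= C + `|r| * D.
  by apply: le_trans (hC _) _; rewrite lerDl mulr_ge0.
have b2 y : `|derive1 psi y| <= C + `|r| * D.
  by rewrite psi'E normrM (@le_trans _ _ (`|r| * D)) ?ler_wpM2l// lerDr.
rewrite -[LHS]/(\int[mu]_y (y * psi y * gauss y)) (gauss_ibp dpsi cpsi' b1 b2) psi'E.
rewrite -RintegralZl//; last exact: heat_integrable.
by apply: eq_Rintegral => y _; rewrite mulrA.
Qed.

Lemma heat_derive_r phi x r : schwartz phi ->
  derivable (fun r => heat r phi x) r 1 /\
  derive1 (fun r => heat r phi x) r = r * heat r (derive1 (derive1 phi)) x.
Proof.
move=> sphi.
have cid : continuous (id : R -> R) by move=> y; exact: cvg_id.
have cx : continuous (cst x : R -> R) by move=> y; exact: cvg_cst.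
have [d ->] := derive_gauss_integral r sphi cid cx (@le_norm_oneDsqr R).
split; first exact: d.
exact: (heat_ibp r x (schwartz_derive1 sphi)).
Qed.

(** The conjugate of multiplication by [x] under the heat flow: it depends on
[r] through the time [r ^+ 2] only. *)
Definition twist r phi : R -> R := mulX phi + (- r ^+ 2) *: derive1 phi.

Lemma schwartz_twist r phi : schwartz phi -> schwartz (twist r phi).
Proof.
move=> sphi; apply: schwartzD; first exact: schwartz_mulX.
exact/schwartzZ/schwartz_derive1.
Qed.

(** Write [x] as [(x + r * y) - r * y] under the integral; the second term is
removed by [heat_ibp]. *)
Lemma mulX_heat r phi : schwartz phi -> mulX (heat r phi) = heat r (twist r phi).
Proof.
move=> sphi; have sphi' := schwartz_derive1 sphi.
have sX := schwartz_mulX sphi.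
rewrite heatD//; last exact: schwartzZ.
rewrite heatZ//.
apply/funext => x.
rewrite -[RHS]/(heat r (mulX phi) x + - r ^+ 2 * heat r (derive1 phi) x) /mulX.
have [C [C0 hC]] := schwartz_bounded sphi.
have i1 : mu.-integrable setT (EFin \o (fun y => y * phi (x + r * y) * gauss y)).
  apply: (@integrableM_gauss _ C (fun y => y * phi (x + r * y))) => //.
    move=> y; apply: cvgM; first exact: cvg_id.
    by apply: continuous_shift; exact: schwartz_continuous.
  by move=> y; rewrite normrM mulrC ler_pM// ?le_norm_oneDsqr// hC.
have i2 : mu.-integrable setT (EFin \o (fun y => r * (y * phi (x + r * y) * gauss y))).
  exact: (@integrableZl _ _ _ mu setT measurableT r _ i1).
have -> : heat r (mulX phi) x =
    x * heat r phi x + r * \int[mu]_y (y * phi (x + r * y) * gauss y).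
  rewrite /heat -RintegralZl//; last exact: heat_integrable.
  rewrite -(RintegralZl r measurableT i1) -RintegralD//; last first.
    exact: (@integrableZl _ _ _ mu setT measurableT x _ (heat_integrable r x sphi)).
  apply: eq_Rintegral => y _; rewrite /mulX.
  by move: (phi _) (gauss y) => u g; ring.
by rewrite heat_ibp// mulNr mulrA -expr2 addrK.
Qed.

Lemma derive1n_heat k r phi : schwartz phi ->
  derive1n k (heat r phi) = heat r (derive1n k phi) /\ schwartz (derive1n k phi).
Proof.
move=> sphi; elim: k => [//|k [IH sk]].
rewrite !derive1nS IH; split; last exact: schwartz_derive1.
by have [_] := heat_derive1 r sk.
Qed.

(** By [mulX_heat], [x ^+ j] times a heat flow is the heat flow of another
Schwartz function, and a heat flow is bounded by the bound of its datum. *)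
Lemma schwartz_heat r phi : schwartz phi -> schwartz (heat r phi).
Proof.
move=> sphi; split=> [k x|j k].
  have [-> sk] := derive1n_heat k r sphi.
  by have [d _] := heat_derive1 r sk; exact: d.
have [-> sk] := derive1n_heat k r sphi.
move: (derive1n k phi) sk => psi spsi {phi sphi}.
elim: j psi spsi => [|j IH] psi spsi.
  have [C [_ hC]] := schwartz_bounded spsi; exists C => x.
  by rewrite expr0 mul1r; exact: heat_bound.
have [C hC] := IH _ (schwartz_twist r spsi); exists C => x.
rewrite exprSr -mulrA -[x * _]/(mulX (heat r psi) x) mulX_heat//; exact: hC.
Qed.

Definition osc_twist r phi : R -> R :=
  2^-1 *: (- derive1 (derive1 phi) + twist r (twist r phi) + phi).

Lemma schwartz_osc_twist r phi : schwartz phi -> schwartz (osc_twist r phi).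
Proof.
move=> sphi; apply/schwartzZ/schwartzD => //; apply: schwartzD.
  by apply/schwartzN; do 2 apply: schwartz_derive1.
by do 2 apply: schwartz_twist.
Qed.

Lemma oscillator_heat r phi : schwartz phi ->
  oscillator (heat r phi) = heat r (osc_twist r phi).
Proof.
move=> sphi; have sphi' := schwartz_derive1 sphi.
have sphi'' := schwartz_derive1 sphi'.
have st := schwartz_twist r sphi; have stt := schwartz_twist r st.
have sN := schwartzZ (-1) sphi''.
have sS := schwartzD sN stt; have sT := schwartzD sS sphi.
have -> : osc_twist r phi =
    2^-1 *: (-1 *: derive1 (derive1 phi) + twist r (twist r phi) + phi).
  by rewrite scaleN1r.
rewrite (heatZ r _ sT) (heatD r sS sphi) (heatD r sN stt) (heatZ r _ sphi'').
rewrite scaleN1r oscillatorE (mulX_heat r sphi) (mulX_heat r st).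
by have [_ ->] := heat_derive1 r sphi; have [_ ->] := heat_derive1 r sphi'.
Qed.

Lemma iter_oscillator_heat m r phi : schwartz phi ->
  iter m oscillator (heat r phi) = heat r (iter m (osc_twist r) phi) /\
  schwartz (iter m (osc_twist r) phi).
Proof.
move=> sphi; elim: m => [//|m [IH sm]] /=.
by rewrite IH oscillator_heat//; split=> //; exact: schwartz_osc_twist.
Qed.

Lemma ge0_integral_shift (h : R -> R) (c : R) : continuous h ->
  (forall x, 0 <= h x) ->
  (\int[mu]_x (h (x + c))%:E = \int[mu]_x (h x)%:E)%E.
Proof.
move=> ch h0; pose F (x : R) := c + x * 1.
have F' : derive1 F = cst 1 by apply/funext => x; exact: derive1_affine.
have FE x : F x = x + c by rewrite /F mulr1 addrC.
rewrite (@increasing_ge0_integration_by_substitutionT _ F h)//.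
- by apply: eq_integral => x _; rewrite F' -[RHS]/((h (F x) * 1)%:E) mulr1 FE.
- by move=> x y xy; rewrite !FE ltrD2r.
- by rewrite F' => x; exact: cvg_cst.
- by rewrite F'; exact: is_cvg_cst.
- by rewrite F'; exact: is_cvg_cst.
- rewrite (_ : F = fun x => x + c); last by apply/funext.
  exact: cvg_addrr_Ny.
- rewrite (_ : F = fun x => x + c); last by apply/funext.
  exact: cvg_addrr.
Qed.

(** By the Jensen inequality the square of [heat r phi x] is at most the
Gaussian mean of [phi (x + r * y) ^+ 2]; integrating in [x] first, each
translate of [phi] contributes the same amount. *)
Lemma ip_heat r phi : schwartz phi -> ip (heat r phi) (heat r phi) <= ip phi phi.
Proof.
move=> sphi; have sh := schwartz_heat r sphi.
have cphi := schwartz_continuous sphi.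
have [C [C0 hC]] := schwartz_bounded sphi.
have cphi2 : continuous (fun x : R => phi x ^+ 2).
  by move=> x; apply: cvgM; exact: cphi.
have i2 x : mu.-integrable setT (EFin \o (fun y => phi (x + r * y) ^+ 2 * gauss y)).
  apply: (@integrable_bounded_gauss _ (C ^+ 2) (fun y => phi (x + r * y) ^+ 2)).
    exact: (continuous_shift (phi := fun z => phi z ^+ 2)).
  by move=> y; rewrite normrX ler_pXn2r// nnegrE// (le_trans _ (hC 0)).
pose f (z : R * R) : \bar R := (phi (z.1 + r * z.2) ^+ 2 * gauss z.2)%:E.
have f0 z : (0 <= f z)%E by rewrite lee_fin mulr_ge0 ?sqr_ge0 ?gauss_ge0.
have mf : measurable_fun setT f.
  apply/measurable_EFinP; apply: measurable_funM.
    apply: (@measurableT_comp _ _ _ _ _ _ (fun x => phi x ^+ 2)).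
      exact: continuous_measurable_fun.
    apply: measurable_funD => //; apply: measurable_funM => //.
  apply: (@measurableT_comp _ _ _ _ _ _ gauss) => //.
  exact: measurable_normal_pdf.
have iphi := schwartzM_integrable sphi sphi.
have main : (\int[mu]_x (heat r phi x * heat r phi x)%:E <=
             \int[mu]_x (phi x * phi x)%:E)%E.
  apply: (@le_trans _ _ (\int[mu]_x \int[mu]_y f (x, y))%E).
    apply: ge0_le_integral => //.
    - by move=> x _; rewrite lee_fin -expr2 sqr_ge0.
    - apply/measurable_EFinP; apply: measurable_funM;
        apply: continuous_measurable_fun; exact: schwartz_continuous.
    - exact: measurable_fun_fubini_tonelli_F.
    - move=> x _; rewrite -expr2.
      apply: (@le_trans _ _ (\int[mu]_y (phi (x + r * y) ^+ 2 * gauss y))%:E).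
        by rewrite lee_fin; apply: (gauss_jensen (continuous_shift cphi)) => y; exact: hC.
      rewrite le_eqVlt; apply/orP; left; apply/eqP; rewrite /Rintegral fineK; first by [].
      exact: (integrable_fin_num measurableT (i2 x)).
  have -> : (\int[mu]_x \int[mu]_y f (x, y) = \int[mu]_y \int[mu]_x f (x, y))%E.
    exact: (fubini_tonelli (m1 := mu) (m2 := mu) f mf f0).
  rewrite le_eqVlt; apply/orP; left; apply/eqP.
  transitivity (\int[mu]_y ((gauss y)%:E * \int[mu]_x (phi x * phi x)%:E))%E.
    apply: eq_integral => y _; rewrite /f/=.
    rewrite -(@ge0_integral_shift (fun x => phi x * phi x) (r * y)); last 2 first.
    - by move=> x; apply: cvgM; exact: cphi.
    - by move=> x; rewrite -expr2 sqr_ge0.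
    rewrite -ge0_integralZl//; last 3 first.
    - apply/measurable_EFinP; apply: measurable_funM;
        apply: continuous_measurable_fun => x; (apply: continuous_comp; last exact: cphi);
        by apply: cvgD; [exact: cvg_id|exact: cvg_cst].
    - by move=> x _; rewrite lee_fin -expr2 sqr_ge0.
    - by rewrite lee_fin gauss_ge0.
    by apply: eq_integral => x _; rewrite -EFinM mulrC expr2.
  rewrite ge0_integralZr//; last 3 first.
  - by apply/measurable_EFinP; exact: measurable_normal_pdf.
  - by move=> y _; rewrite lee_fin gauss_ge0.
  - by apply: integral_ge0 => x _; rewrite lee_fin -expr2 sqr_ge0.
  by rewrite integral_normal_pdf mul1e.
apply: fine_le => //.
- exact: integrable_fin_num (schwartzM_integrable sh sh).
- exact: integrable_fin_num iphi.
Qed.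

(** The norm of order [m] of a heat flow is the L2 norm of the heat flow of
[iter m (osc_twist r) phi].  The contraction removes the flow, and
[osc_twist r] is a combination of bounded operators with coefficients bounded
in [r]. *)
Lemma tempered_heat (M : R) :
  tempered_family [set r | `|r| <= M] heat.
Proof.
set D := [set r | _].
have tt : tempered_family D twist.
  apply: tempered_add; first exact: tempered_mulX.
  apply: (@tempered_scale _ D (fun r => - r ^+ 2) (M ^+ 2)).
    move=> r /= rM; rewrite normrN normrX ler_pXn2r ?nnegrE//.
    exact: le_trans rM.
  exact: tempered_derive1.
have to : tempered_family D osc_twist.
  apply: (@tempered_scale _ D (cst 2^-1) (2^-1)).
    by move=> r _ /=; rewrite ger0_norm// invr_ge0.
  apply: tempered_add; last exact: tempered_id.
  apply: tempered_add; last exact: tempered_comp.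
  have := @tempered_scale _ D (cst (-1)) 1 _ _
    (tempered_comp (@tempered_derive1 _ D) (@tempered_derive1 _ D)).
  rewrite (_ : (fun _ _ => _) = fun=> (fun phi => - derive1 (derive1 phi))).
    by apply => r _; rewrite normrN1.
  by apply/funext => r; apply/funext => phi; rewrite scaleN1r.
split=> [r phi _|m]; first exact: schwartz_heat.
have [_ /(_ 0%N)[C [k [C0 hC]]]] := tempered_iter m to.
exists C, k; split=> // r phi Dr sphi; apply: le_trans (hC _ _ Dr sphi).
have [E sm] := iter_oscillator_heat m r sphi.
by rewrite !snormE /= E; apply: ler_wsqrtr; exact: ip_heat.
Qed.

End Heat.

(** * Differentiation in time *)

Section TimeDerivative.
Context {R : realType}.
Implicit Types (T t s x : R) (u v w : R -> R) (phi : R -> R).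

(** Every point of a nondegenerate segment is a limit of other points of it, so
that the one-sided limits defining [derive_on] are unique. *)
Lemma within_itv_dnbhs_proper T t : 0 < T -> 0 <= t <= T ->
  ProperFilter (within `[0, T]%classic t^').
Proof.
move=> T0 /andP[t0 tT]; apply: Build_ProperFilter_ex => A.
rewrite /within/= => /nbhs_ballP[e /= e0 eA].
have [tT'|Tt] := ltP t T.
  pose s := t + Num.min (e / 2) (T - t).
  have m0 : 0 < Num.min (e / 2) (T - t) by rewrite lt_min divr_gt0//= subr_gt0.
  have m1 : Num.min (e / 2) (T - t) <= e / 2 by rewrite ge_min lexx.
  have m2 : Num.min (e / 2) (T - t) <= T - t by rewrite ge_min lexx orbT.
  exists s; apply: eA.
  - rewrite /ball/= /s opprD addNKr normrN gtr0_norm//.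
    by apply: le_lt_trans m1 _; rewrite ltr_pdivrMr// ltr_pMr// ltr1n.
  - by rewrite gt_eqF// /s ltrDl.
  - rewrite /= in_itv/= /s; apply/andP; split; first by rewrite addr_ge0// ltW.
    by rewrite addrC -lerBrDr.
have E : t = T by apply/eqP; rewrite eq_le tT.
rewrite E in eA.
pose s := T - Num.min (e / 2) T.
have m0 : 0 < Num.min (e / 2) T by rewrite lt_min divr_gt0.
have m1 : Num.min (e / 2) T <= e / 2 by rewrite ge_min lexx.
have m2 : Num.min (e / 2) T <= T by rewrite ge_min lexx orbT.
exists s; apply: eA.
- rewrite /ball/= /s opprB addrCA subrr addr0 gtr0_norm//.
  by apply: le_lt_trans m1 _; rewrite ltr_pdivrMr// ltr_pMr// ltr1n.
- by rewrite lt_eqF// /s ltrBlDr ltrDl.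
- rewrite /= in_itv/= /s subr_ge0 m2/= lerBlDr lerDl.
  exact: ltW.
Qed.

(** By the mean value theorem a difference quotient on [[0, T]] is a value of
[w] at an interior point; continuity of [w] then yields the derivative at every
point, including the end point [0], where [u] itself need not be known to be
differentiable. *)
Lemma cvg_diff_quot T v u w : (forall t, 0 <= t <= T -> v t = u t) ->
  continuous u -> continuous w -> (forall t, 0 < t -> is_derive t 1 u (w t)) ->
  forall t, 0 <= t <= T ->
    diff_quot v t s @[s --> within `[0, T]%classic t^'] --> w t.
Proof.
move=> vu cu cw du t tT; have /andP[t0 _] := tT.
apply/cvgrPdist_le => e e0; rewrite /within/=.
have /cvgrPdist_le/(_ e e0)/nbhs_ballP[d /= d0 dw] := cw t.
have slope a b : 0 <= a -> a < b ->
    exists2 c, c \in `]a, b[%R & u b - u a = w c * (b - a).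
  move=> a0 ab; apply: MVT => //.
    by move=> x; rewrite in_itv/= => /andP[ax _]; apply: du; exact: le_lt_trans ax.
  exact: continuous_subspaceT.
apply/nbhs_ballP; exists d => //= s sd st; rewrite in_itv/= => sT.
have /andP[s0 _] := sT.
rewrite /diff_quot !vu//; rewrite /ball/= in sd.
have [lt_st|lt_ts|E] := ltgtP s t; last by rewrite E eqxx in st.
  have [c] := slope s t s0 lt_st; rewrite in_itv/= => /andP[sc ct] Ec.
  have -> : (u s - u t) / (s - t) = w c.
    rewrite -[u s - u t]opprB -[s - t]opprB invrN mulrNN Ec mulfK//.
    by rewrite subr_eq0 gt_eqF.
  apply: dw; rewrite /ball/=; apply: le_lt_trans sd.
  by rewrite !ger0_norm ?subr_ge0 ?(ltW ct) ?(ltW lt_st)// lerD2l lerN2 ltW.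
have [c] := slope t s t0 lt_ts; rewrite in_itv/= => /andP[tc cs] Ec.
have -> : (u s - u t) / (s - t) = w c.
  by rewrite Ec mulfK// subr_eq0 gt_eqF.
apply: dw; rewrite /ball/=; apply: le_lt_trans sd.
rewrite distrC (distrC t) !ger0_norm ?subr_ge0 ?(ltW tc) ?(ltW lt_ts)//.
by rewrite lerD2r ltW.
Qed.

Lemma C1_on_of_derive T v u w : 0 < T -> (forall t, 0 <= t <= T -> v t = u t) ->
  continuous u -> continuous w -> (forall t, 0 < t -> is_derive t 1 u (w t)) ->
  C1_on T v /\ forall t, 0 <= t <= T -> derive_on T v t = w t.
Proof.
move=> T0 vu cu cw du; have cv := cvg_diff_quot vu cu cw du.
have dE t : 0 <= t <= T -> derive_on T v t = w t.
  move=> tT; have PF := within_itv_dnbhs_proper T0 tT.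
  by apply/cvg_lim => //; exact: cv.
split; last exact: dE.
split=> [t tT|]; first by apply/cvg_ex; exists (w t); exact: cv.
apply: (@subspace_eq_continuous _ _ _ w (derive_on T v)).
  by move=> t; rewrite inE/= in_itv/= => tT; exact/esym/dE.
exact: continuous_subspaceT.
Qed.

Lemma derive_onD T u v t : 0 < T -> 0 <= t <= T -> C1_on T u -> C1_on T v ->
  derive_on T (fun s => u s + v s) t = derive_on T u t + derive_on T v t.
Proof.
move=> T0 tT [cu _] [cv _]; have PF := within_itv_dnbhs_proper T0 tT.
apply/cvg_lim => //.
have -> : diff_quot (fun s => u s + v s) t = diff_quot u t + diff_quot v t.
  apply/funext => s; rewrite /diff_quot -[RHS]/((u s - u t) / (s - t) + (v s - v t) / (s - t)).
  by rewrite -mulrDl; congr (_ / _); rewrite opprD addrACA.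
apply: cvgD; [exact: cu|exact: cv].
Qed.

(** The factor [r] of [heat_derive_r] cancels against the derivative of the
square root, which leaves a function of time continuous up to [0]. *)
Lemma heat_equation phi x : schwartz phi ->
  let u t := heat (Num.sqrt t) phi x in
  let w t := 2^-1 * heat (Num.sqrt t) (derive1 (derive1 phi)) x in
  [/\ continuous u, continuous w & forall t, 0 < t -> is_derive t 1 u (w t)].
Proof.
move=> sphi u w; have sphi'' := schwartz_derive1 (schwartz_derive1 sphi).
have cont psi : schwartz psi -> continuous (fun t => heat (Num.sqrt t) psi x).
  move=> spsi t; apply: (@continuous_comp _ _ _ Num.sqrt (fun r => heat r psi x)).
    exact: sqrt_continuous.
  apply/differentiable_continuous/derivable1_diffP.
  by have [] := heat_derive_r x (Num.sqrt t) spsi.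
split; first exact: cont.
  by move=> t; apply: cvgM; [exact: cvg_cst|exact: cont].
move=> t t0; have r0 : 0 < Num.sqrt t by rewrite sqrtr_gt0.
have [dsq dsqE] := is_derive1_sqrt t0.
have [dh dhE] := heat_derive_r x (Num.sqrt t) sphi.
have uE : u = (fun r => heat r phi x) \o Num.sqrt by [].
apply: DeriveDef.
  by rewrite uE; apply: derivable1_comp; [exact: dsq|exact: dh].
rewrite -derive1E uE derive1_comp; [|exact: dsq|exact: dh].
rewrite dhE derive1E dsqE /w invfM.
move: (heat _ _ _) => h.
have r1 : Num.sqrt t != 0 by rewrite gt_eqF.
by field.
Qed.

End TimeDerivative.

(** * Sequence spaces and cosets *)

Section Sequences.
Context {R : realType}.
Implicit Types (a b c : nat -> R) (K : R).

(** Two dominating sequences are allowed because of sums; the other uses take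
one of them to be [0]. *)
Lemma rapid_seq_dominated K a b c : rapid_seq b -> rapid_seq c ->
  (forall n, `|a n| <= K * (`|b n| + `|c n|)) -> rapid_seq a.
Proof.
move=> rb rc abc m; have rbm := rb m; have rcm := rc m.
pose B n : \bar R := (n.+1%:R ^+ (2 * m) * `|b n| ^+ 2)%:E.
pose C n : \bar R := (n.+1%:R ^+ (2 * m) * `|c n| ^+ 2)%:E.
have B0 n : (0 <= B n)%E by rewrite lee_fin mulr_ge0 ?exprn_ge0.
have C0 n : (0 <= C n)%E by rewrite lee_fin mulr_ge0 ?exprn_ge0.
have k0 : 0 <= 2 * K ^+ 2 by rewrite mulr_ge0// sqr_ge0.
apply: (@le_lt_trans _ _ (\sum_(0 <= n <oo) ((2 * K ^+ 2)%:E * (B n + C n)))%E).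
  apply: lee_nneseries => [n _ _|n _].
    by rewrite lee_fin mulr_ge0 ?exprn_ge0.
  rewrite -EFinD -EFinM lee_fin -mulrDr [leRHS]mulrCA ler_wpM2l ?exprn_ge0//.
  apply: (@le_trans _ _ ((K * (`|b n| + `|c n|)) ^+ 2)).
    by rewrite ler_pXn2r ?nnegrE ?(le_trans _ (abc n)).
  rewrite exprMn (mulrC 2) -(mulrA (K ^+ 2) 2) ler_wpM2l ?sqr_ge0//.
  move: `|b n| `|c n| => x y; have := sqr_ge0 (x - y).
  by rewrite sqrrB sqrrD; lra.
rewrite nneseriesZl; last by move=> n _; exact: adde_ge0.
rewrite nneseriesD; [|by move=> n _ _; exact: B0|by move=> n _ _; exact: C0].
apply: lte_mul_pinfty; rewrite ?lee_fin//.
by apply: lte_add_pinfty.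
Qed.

Lemma rapid_seq0 : rapid_seq (fun=> 0 : R).
Proof.
move=> m; rewrite eseries0 ?ltry// => n _ _.
by rewrite normr0 expr0n mulr0.
Qed.

Lemma slow_seq_dominated K a b : 0 <= K -> slow_seq b ->
  (forall n, `|a n| <= K * `|b n|) -> slow_seq a.
Proof.
move=> K0 [C [m hC]] ab; exists (K * C), m => n.
by apply: le_trans (ab n) _; rewrite -mulrA ler_wpM2l.
Qed.

End Sequences.

Section Cosets.
Context {R : realType}.
Implicit Types (f g h : nat -> R -> R) (G : set (nat -> R -> R)).

Lemma snorm0 m : snorm m (0 : R -> R) = 0.
Proof.
have := snormZ m 0 (@schwartz0 R); rewrite scale0r normr0 mul0r.
by [].
Qed.

Lemma tempered_rapidD f g : tempered_seq rapid_seq f -> tempered_seq rapid_seq g ->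
  tempered_seq rapid_seq (f + g).
Proof.
move=> [sf rf] [sg rg]; split=> [n|m]; first exact: schwartzD.
apply: (@rapid_seq_dominated _ 2 _ _ _ (rf m) (rg m)) => n.
rewrite !ger0_norm ?snorm_ge0//; exact: snormD.
Qed.

Lemma tempered_rapid_map (L : (R -> R) -> R -> R) f :
  tempered_family setT (fun=> L) -> tempered_seq rapid_seq f ->
  tempered_seq rapid_seq (fun n => L (f n)).
Proof.
move=> [sL bL] [sf rf]; split=> [n|m]; first exact: (sL 0).
have [C [k [C0 hC]]] := bL m.
apply: (@rapid_seq_dominated _ C _ _ _ (rf k) rapid_seq0) => n.
rewrite normr0 addr0 !ger0_norm ?snorm_ge0//; exact: (hC 0).
Qed.

Lemma tempered_rapidN f : tempered_seq rapid_seq f -> tempered_seq rapid_seq (- f).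
Proof.
move=> rf.
have tN : tempered_family setT (fun=> (fun phi : R -> R => - phi)).
  have := @tempered_scale R setT (cst (-1)) 1 _ _ (@tempered_id R setT).
  rewrite (_ : (fun _ _ => _) = fun=> (fun phi : R -> R => - phi)).
    by apply => r _; rewrite normrN1.
  by apply/funext => r; apply/funext => phi; rewrite scaleN1r.
exact: (tempered_rapid_map tN rf).
Qed.

Lemma tclass_eq f g : tempered_seq rapid_seq (f - g) -> tclass f = tclass g.
Proof.
move=> rfg; apply/seteqP; split=> h /= rh.
  by have := tempered_rapidD rh rfg; rewrite addrA subrK.
by have := tempered_rapidD rh (tempered_rapidN rfg); rewrite opprB addrA subrK.
Qed.

Lemma tempered_rapid0 : tempered_seq rapid_seq (0 : nat -> R -> R).
Proof.
split=> [n|m]; first exact: schwartz0.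
by under eq_fun do rewrite snorm0; exact: rapid_seq0.
Qed.

(** For an operation that respects the congruences the union defining
[induced] is a union of equal cosets. *)
Lemma induced_eq (A : Type) (D : A -> nat -> R -> R) (G : set A) (g : A) f : G g ->
  (forall k, G k -> tempered_seq rapid_seq (D k - f)) -> Defs.induced D G = tclass f.
Proof.
move=> Gg DG; apply/seteqP; split=> h.
  by move=> [k Gk] /=; rewrite (tclass_eq (DG k Gk)).
by move=> hf; exists g; [exact: Gg|rewrite (tclass_eq (DG g Gg)); exact: hf].
Qed.

End Cosets.

Section TimeCosets.
Context {R : realType}.
Variable T : R.
Hypothesis T0 : 0 < T.
Implicit Types (g h k : nat -> R -> R -> R).

Lemma sup_norms_rapid k m t : sup_norms_in T rapid_seq m k -> 0 <= t <= T ->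
  rapid_seq (fun n => snorm m (k n t)).
Proof.
move=> [ub rk] tT; apply: (@rapid_seq_dominated _ 1 _ _ _ rk rapid_seq0) => n.
rewrite normr0 addr0 mul1r ger0_norm ?snorm_ge0//.
apply: le_trans (ler_norm _); apply: ub_le_sup => //.
by exists t => //; rewrite /= in_itv.
Qed.

Lemma temperedT_rapid_at k t : temperedT_seq T rapid_seq k -> 0 <= t <= T ->
  tempered_seq rapid_seq (fun n => k n t).
Proof.
move=> [sk _ rk _] tT; split=> [n|m]; first by case: (sk n) => + _; exact.
exact: sup_norms_rapid.
Qed.

Lemma temperedT_rapid_dt k t : temperedT_seq T rapid_seq k -> 0 <= t <= T ->
  tempered_seq rapid_seq (fun n => dt T (k n) t).
Proof.
move=> [_ sk _ rk] tT; split=> [n|m]; first exact: sk.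
exact: (@sup_norms_rapid (fun n => dt T (k n))).
Qed.

Lemma temperedT_rapid0 : temperedT_seq T rapid_seq (0 : nat -> R -> R -> R).
Proof.
have c0 : continuous (cst 0 : R -> R) by move=> t; exact: cvg_cst.
have [C10 dE] := @C1_on_of_derive R T (fun=> 0) (fun=> 0) (fun=> 0) T0
  (fun t _ => erefl) c0 c0 (fun t _ => is_derive_cst 0 t 1).
have d0 n t : 0 <= t <= T -> dt T ((0 : nat -> R -> R -> R) n) t = 0.
  by move=> tT; apply/funext => x; exact: dE.
have z m (k : nat -> R -> R -> R) : (forall n t, 0 <= t <= T -> k n t = 0) ->
    sup_norms_in T rapid_seq m k.
  move=> k0.
  have E n : [set snorm m (k n t) | t in `[0, T]] = [set 0].
    apply/seteqP; split=> [_ [t /= tT <-]|_ ->].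
      by rewrite k0 ?snorm0//; move: tT; rewrite in_itv.
    have T0' : 0 <= (0 : R) <= T by rewrite lexx ltW.
    by exists 0; rewrite ?k0 ?snorm0//= in_itv.
  split=> [n|]; first by rewrite E; exists 0 => _ ->.
  by under eq_fun do rewrite E sup1; exact: rapid_seq0.
split=> [n|n t tT|m|m].
- by split=> [t _|x]; [exact: schwartz0|exact: C10].
- by rewrite d0//; exact: schwartz0.
- by apply: z.
- by apply: z => n t tT; exact: d0.
Qed.

(** Written as [u = (u - v) + v]: only [u - v] and [v] are known to be
differentiable in time. *)
Lemma dtB (u v : R -> R -> R) t : 0 <= t <= T -> schwartz_on T (u - v) ->
  schwartz_on T v -> dt T u t - dt T v t = dt T (u - v) t.
Proof.
move=> tT [_ c1] [_ c2]; apply/funext => x.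
rewrite -[LHS]/(dt T u t x - dt T v t x).
have -> : dt T u t x = dt T (u - v) t x + dt T v t x.
  rewrite /dt -derive_onD//; congr (derive_on _ _ _).
  apply/funext => s; rewrite -[(u - v) s x]/(u s x - v s x); exact/esym/subrK.
exact: addrK.
Qed.

End TimeCosets.

(** * The law of Brownian motion *)

Section Normal.
Context {R : realType}.
Local Notation mu := (@lebesgue_measure R).

(** The normal law is given by its values on sets; its density is a
Radon-Nikodym derivative by uniqueness of the latter. *)
Lemma integral_normal_prob (m s : R) (f : R -> R) :
  (normal_prob m s).-integrable setT (EFin \o f) ->
  (\int[normal_prob m s]_x (f x)%:E = \int[mu]_x (f x * normal_pdf m s x)%:E)%E.
Proof.
move=> intf.
have mp : measurable_fun setT (EFin \o normal_pdf m s).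
  by apply/measurable_EFinP; exact: measurable_normal_pdf.
have dom := normal_prob_dominates m s.
rewrite -(Radon_Nikodym_change_of_variables dom measurableT intf).
have mf := measurable_int _ intf.
apply: ae_eq_integral => //.
- exact: emeasurable_funM.
- by under eq_fun do rewrite EFinM; exact: emeasurable_funM.
rewrite [X in ae_eq _ _ _ X](_ : _ = (EFin \o f) \* (EFin \o normal_pdf m s))%E; last first.
  by apply/funext => x; rewrite /= EFinM.
apply: ae_eqe_mul2l; apply: integral_ae_eq => //.
  by apply: Radon_Nikodym_integrable; exact: dom.
by move=> E _ mE; rewrite -Radon_Nikodym_integral.
Qed.

Lemma normal_pdf_scale (s y : R) : 0 < s -> normal_pdf 0 s (s * y) * s = gauss y.
Proof.
move=> s0; rewrite gaussE normal_pdfE ?gt_eqF// /normal_fun subr0.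
rewrite -[RHS]/(normal_peak 1 * expR (- (2^-1 * y ^+ 2))).
have -> : - (s * y) ^+ 2 / (s ^+ 2 *+ 2) = - (2^-1 * y ^+ 2).
  by rewrite -mulr_natr; field; rewrite gt_eqF.
rewrite mulrAC; congr (_ * _).
rewrite /normal_peak expr1n mul1r -mulrnAr sqrtrM ?sqr_ge0// sqrtr_sqr gtr0_norm//.
by rewrite invfM mulrC mulrA divff ?gt_eqF// mul1r.
Qed.

(** The substitution [y := s * y], applied to [phi + K] with [K] a bound of
[phi]: the change of variables is for nonnegative functions. *)
Lemma integral_normal_heat (s x : R) (phi : R -> R) : 0 < s -> schwartz phi ->
  \int[mu]_y (phi (y + x) * normal_pdf 0 s y) = heat s phi x.
Proof.
move=> s0 sphi; have [K [K0 hK]] := schwartz_bounded sphi.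
have cphi := schwartz_continuous sphi.
have cs y : {for y, continuous (fun y : R => phi (y + x))}.
  apply: continuous_comp; last exact: cphi.
  by apply: cvgD; [exact: cvg_id|exact: cvg_cst].
have cpdf : continuous (normal_pdf 0 s) by apply: continuous_normal_pdf; rewrite gt_eqF.
have ip := integrable_normal_pdf 0 s.
have i1 : mu.-integrable setT (EFin \o (fun y => phi (y + x) * normal_pdf 0 s y)).
  apply: (@le_integrable _ _ _ mu setT measurableT _
      (fun y => K%:E * (normal_pdf 0 s y)%:E)%E).
  - apply/measurable_EFinP; apply: measurable_funM.
      by apply: continuous_measurable_fun => y; exact: cs.
    exact: measurable_normal_pdf.
  - move=> y _ /=; rewrite lee_fin normrM [leRHS]ger0_norm.
      by rewrite (ger0_norm (normal_pdf_ge0 _ _ _)) ler_wpM2r// normal_pdf_ge0.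
    by rewrite mulr_ge0// normal_pdf_ge0.
  - exact: integrableZl ip.
have i2 := heat_integrable s x sphi.
have iK : mu.-integrable setT (EFin \o (fun y => K * normal_pdf 0 s y)).
  exact: (@integrableZl _ _ _ mu setT measurableT K _ ip).
have iK1 : mu.-integrable setT (EFin \o (fun y => K * gauss y)).
  exact: (@integrableZl _ _ _ mu setT measurableT K _ (integrable_normal_pdf 0 1)).
pose F (y : R) := 0 + y * s.
have FE y : F y = s * y by rewrite /F add0r mulrC.
have F' : derive1 F = cst s by apply/funext => y; exact: derive1_affine.
pose G y := (phi (y + x) + K) * normal_pdf 0 s y.
have cG : continuous G.
  move=> y; apply: cvgM; last exact: cpdf.
  by apply: cvgD; [exact: cs|exact: cvg_cst].
have G0 y : 0 <= G y.
  rewrite mulr_ge0 ?normal_pdf_ge0// -lerBlDr sub0r.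
  by have := hK (y + x); rewrite ler_norml => /andP[].
have key : (\int[mu]_y (G y)%:E = \int[mu]_y ((phi (x + s * y) + K) * gauss y)%:E)%E.
  rewrite (@increasing_ge0_integration_by_substitutionT _ F G)//.
  - apply: eq_integral => y _; rewrite F' -[LHS]/((G (F y) * s)%:E) FE /G.
    by rewrite -mulrA normal_pdf_scale// (addrC x).
  - by move=> y z yz; rewrite !FE ltr_pM2l.
  - by rewrite F' => y; exact: cvg_cst.
  - by rewrite F'; exact: is_cvg_cst.
  - by rewrite F'; exact: is_cvg_cst.
  - rewrite (_ : F = fun y => s * y); last by apply/funext.
    by apply: gt0_cvgMrNy => //; exact: cvg_id.
  - rewrite (_ : F = fun y => s * y); last by apply/funext.
    by apply: gt0_cvgMry => //; exact: cvg_id.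
(* Adding [K] to both sides turns them into the integrals of [key]. *)
apply: (addIr K).
have EK : \int[mu]_y (K * normal_pdf 0 s y) = K.
  by rewrite (RintegralZl K measurableT ip) /Rintegral integral_normal_pdf mulr1.
have EK1 : \int[mu]_y (K * gauss y) = K.
  rewrite (RintegralZl K measurableT (integrable_normal_pdf 0 1)).
  by rewrite Rintegral_gauss mulr1.
transitivity (\int[mu]_y G y).
  rewrite -[X in _ + X = _]EK -(RintegralD measurableT i1 iK).
  by apply: eq_Rintegral => y _; rewrite /G mulrDl.
rewrite -[X in _ = _ + X]EK1 /heat -(RintegralD measurableT i2 iK1).
rewrite /Rintegral key; congr fine.
by apply: eq_integral => y _; congr EFin; exact: mulrDl.
Qed.

End Normal.

(** The values of [X] are taken in [measurableTypeR R], the copy of the real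
line that carries the normal laws; its Borel sets are those of [R]. *)
Lemma integral_law (R : realType) (d : measure_display) (Omega : measurableType d)
    (P : probability Omega R) (X : Omega -> measurableTypeR R)
    (Q : probability (measurableTypeR R) R) (h : measurableTypeR R -> R) :
  measurable_fun setT X -> measurable_fun setT h ->
  (forall A, measurable A -> P (X @^-1` A) = Q A) ->
  P.-integrable setT (EFin \o (h \o X)) ->
  (\int[P]_w (h (X w))%:E = \int[Q]_y (h y)%:E)%E.
Proof.
move=> mX mh law ih; rewrite -[in LHS](preimage_setT X).
have mEh : measurable_fun setT (EFin \o h) by exact/measurable_EFinP.
rewrite -(integral_pushforward mX mEh _ measurableT); last by rewrite preimage_setT.
apply: (@eq_measure_integral _ _ _ _ Q) => A mA _; exact: law.
Qed.

Section Brownian.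
Context {R : realType} {d : measure_display} {Omega : measurableType d}.
Context {P : probability Omega R}.
Variable B : R -> {RV P >-> R}.
Hypothesis hB : standard_brownian_motion B.
Local Notation mu := (@lebesgue_measure R).

(** For [t > 0] replace [B t] by the increment [B t - B 0], equal to it almost
surely and normal with variance [t]. *)
Lemma brownian_heat (phi : R -> R) (t x : R) : schwartz phi -> 0 <= t ->
  fine 'E_P[fun w => phi (B t w + x)] = heat (Num.sqrt t) phi x.
Proof.
move=> sphi t0; have [B0 _ gB _] := hB.
have cphi := schwartz_continuous sphi.
have [K [K0 hK]] := schwartz_bounded sphi.
have mphi : measurable_fun setT (fun y : R => phi (y + x)).
  apply: continuous_measurable_fun => y; apply: continuous_comp; last exact: cphi.
  by apply: cvgD; [exact: cvg_id|exact: cvg_cst].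
have mB s : measurable_fun setT (B s) by exact: measurable_funPT.
have mphiB s : measurable_fun setT (fun w => phi (B s w + x)).
  exact: (measurableT_comp mphi (mB s)).
rewrite unlock.
move: t0; rewrite le_eqVlt => /predU1P[<-|t0].
  rewrite sqrtr0 heat0.
  rewrite (@ae_eq_integral _ _ _ P setT (cst (phi x)%:E))//.
  - rewrite integral_cst// -[fine _]/(fine ((phi x)%:E * P setT)%E).
    by rewrite probability_setT mule1.
  - exact/measurable_EFinP.
  - by apply: filterS B0 => w /= -> _; rewrite add0r.
pose X w := B t w - B 0 w.
have mX : measurable_fun setT X by exact: measurable_funB.
have iX : P.-integrable setT (EFin \o ((fun y => phi (y + x)) \o X)).
  apply: (@measurable_bounded_integrable _ _ _ P (fun w => phi (X w + x)) setT) => //.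
  - exact: le_lt_trans (probability_le1 P measurableT) (ltry _).
  - exact: (measurableT_comp mphi mX).
  exists K; split; first exact: num_real.
    by move=> M KM w _ /=; apply: le_trans (hK _) _; exact: ltW.
have mEphi : measurable_fun setT (EFin \o (fun y : R => phi (y + x))).
  exact/measurable_EFinP.
rewrite (@ae_eq_integral _ _ _ P setT (fun w => (phi (X w + x))%:E))//; last 3 first.
- exact/measurable_EFinP.
- by apply/measurable_EFinP; exact: (measurableT_comp mphi mX).
- by apply: filterS B0 => w /= B0w _; rewrite /X B0w subr0.
have law A : measurable A -> P (X @^-1` A) = normal_prob 0 (Num.sqrt t) A.
  by move=> mA; have := gB 0 t A (lexx 0) t0 mA; rewrite subr0.
have -> : (\int[P]_w (phi (X w + x))%:E =
    \int[normal_prob 0 (Num.sqrt t)]_y (phi (y + x))%:E)%E.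
  exact: (integral_law (Q := normal_prob 0 (Num.sqrt t)) (h := fun y => phi (y + x))).
have s0 : 0 < Num.sqrt t by rewrite sqrtr_gt0.
rewrite -(integral_normal_heat x s0 sphi) /Rintegral -integral_normal_prob//.
apply: (@measurable_bounded_integrable _ _ _ (normal_prob 0 (Num.sqrt t))
  (fun y => phi (y + x)) setT) => //.
- exact: le_lt_trans (probability_le1 (normal_prob 0 (Num.sqrt t)) measurableT) (ltry _).
exists K; split; first exact: num_real.
  by move=> M KM w _ /=; apply: le_trans (hK _) _; exact: ltW.
Qed.

End Brownian.

(** * Operations on classes and the Cauchy problem *)

Section Operations.
Context {R : realType}.
Variable T : R.
Hypothesis T0 : 0 < T.
Implicit Types (g h k : nat -> R -> R -> R).

Lemma tclassT_refl g : tclassT T g g.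
Proof. by rewrite /tclassT/= subrr; exact: temperedT_rapid0. Qed.

Lemma at_time_tclassT g t : 0 <= t <= T ->
  at_time t (tclassT T g) = tclass (fun n => g n t).
Proof.
move=> tT; apply: (induced_eq (tclassT_refl g)) => h hg.
exact: (temperedT_rapid_at hg tT).
Qed.

Lemma Dt_tclassT g t : 0 <= t <= T -> (forall n, schwartz_on T (g n)) ->
  Dt T t (tclassT T g) = tclass (fun n => dt T (g n) t).
Proof.
move=> tT sg; apply: (induced_eq (tclassT_refl g)) => h hg.
have -> : (fun n => dt T (h n) t) - (fun n => dt T (g n) t) =
    fun n => dt T ((h - g) n) t.
  by apply/funext => n; apply: dtB => //; case: hg => + _ _ _; exact.
exact: (temperedT_rapid_dt hg tT).
Qed.

Lemma Dx2_tclassT g t : 0 <= t <= T -> (forall n, schwartz (g n t)) ->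
  Dx2 t (tclassT T g) = tclass (fun n => derive1n 2 (g n t)).
Proof.
move=> tT sg; apply: (induced_eq (tclassT_refl g)) => h hg.
have rhg := temperedT_rapid_at hg tT.
have -> : (fun n => derive1n 2 (h n t)) - (fun n => derive1n 2 (g n t)) =
    fun n => derive1n 2 ((h - g) n t).
  apply/funext => n; have shg : schwartz ((h - g) n t) by case: rhg => + _; exact.
  have hE : h n t = (h - g) n t + g n t.
    by rewrite -[(h - g) n t]/(h n t - g n t) subrK.
  rewrite -[LHS]/(derive1n 2 (h n t) - derive1n 2 (g n t)) hE.
  by rewrite (derive1nD 2 shg (sg n)) addrK.
have tdd := tempered_comp (@tempered_derive1 R setT) (@tempered_derive1 R setT).
exact: (tempered_rapid_map tdd rhg).
Qed.

Lemma tscale_tclass (c : R) (f : nat -> R -> R) :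
  tscale c (tclass f) = tclass (fun n x => c * f n x).
Proof.
apply: (@induced_eq _ _ _ _ f); first by rewrite /tclass/= subrr; exact: tempered_rapid0.
move=> h hf.
have -> : (fun n x => c * h n x) - (fun n x => c * f n x) = fun n => c *: (h - f) n.
  by apply/funext => n; apply/funext => x; rewrite -[RHS]/(c * (h n x - f n x)) mulrBr.
have tc : tempered_family setT (fun=> ( *:%R c : (R -> R) -> R -> R)).
  exact: (@tempered_scale R setT (cst c) `|c| _ (fun r _ => lexx _)
    (@tempered_id R setT)).
exact: (tempered_rapid_map tc hf).
Qed.

Lemma tempered_reparam (D D' : set R) L (s : R -> R) : tempered_family D L ->
  (forall t, D' t -> D (s t)) -> tempered_family D' (fun t => L (s t)).
Proof.
move=> [sL bL] DD; split=> [t phi D't|m]; first exact/sL/DD.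
have [C [k [C0 hC]]] := bL m; exists C, k; split=> // t phi D't.
exact/hC/DD.
Qed.

Lemma sup_norms_slow (f : nat -> R -> R) L k m : tempered_seq slow_seq f ->
  tempered_family `[0, T]%classic L ->
  (forall n t, 0 <= t <= T -> k n t = L t (f n)) -> sup_norms_in T slow_seq m k.
Proof.
move=> [sf rf] [sL bL] kL; have [C [j [C0 hC]]] := bL m.
have bd n y : [set snorm m (k n t) | t in `[0, T]] y -> 0 <= y <= C * snorm j (f n).
  move=> [t /= tT <-]; rewrite snorm_ge0 kL; last by move: tT; rewrite in_itv.
  exact: hC.
have ne n : [set snorm m (k n t) | t in `[0, T]] (snorm m (k n 0)).
  by exists 0 => //; rewrite /= in_itv/= lexx ltW.
have ub n : has_ubound [set snorm m (k n t) | t in `[0, T]].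
  by exists (C * snorm j (f n)) => y /bd/andP[].
split=> //; apply: (slow_seq_dominated C0 (rf j)) => n.
rewrite (ger0_norm (snorm_ge0 _ _)) ger0_norm.
  by apply: ge_sup; [exists (snorm m (k n 0)); exact: ne|move=> y /bd/andP[]].
by apply: le_trans (snorm_ge0 m (k n 0)) _; apply: ub_le_sup; [exact: ub|exact: ne].
Qed.

End Operations.

Theorem corollary6p4 (R : realType) (d : measure_display)
    (Omega : measurableType d) (P : probability Omega R)
    (B : R -> {RV P >-> R}) (hB : standard_brownian_motion B)
    (T : R) (hT : 0 < T)
    (f : nat -> R -> R) (hf : tempered_seq slow_seq f) :
  let gn := fun (n : nat) (t x : R) => fine 'E_P[fun w => f n (B t w + x)] in
  let g := tclassT T gn in
  [/\ tempered_algebraT T g,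
      forall t, 0 <= t <= T ->
        at_time t g = tclass (fun n => gn n t),
      forall t, 0 <= t <= T -> Dt T t g = tscale 2^-1 (Dx2 t g)
    & at_time 0 g = tclass f].
Proof.
move=> gn g; have [sf _] := hf.
have gnE n t : 0 <= t -> gn n t = heat (Num.sqrt t) (f n).
  by move=> t0; apply/funext => x; exact: brownian_heat.
have itvP t : 0 <= t <= T -> 0 <= t by case/andP.
have heatE n x : C1_on T (gn n ^~ x) /\ forall t, 0 <= t <= T ->
    derive_on T (gn n ^~ x) t =
    2^-1 * heat (Num.sqrt t) (derive1 (derive1 (f n))) x.
  have [cu cw du] := heat_equation x (sf n).
  by apply: (C1_on_of_derive hT _ cu cw du) => t /itvP t0; rewrite gnE.
have dtE n t : 0 <= t <= T ->
    dt T (gn n) t = 2^-1 *: heat (Num.sqrt t) (derive1 (derive1 (f n))).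
  by move=> tT; apply/funext => x; exact: ((heatE n x).2 t tT).
have dxE n t : 0 <= t ->
    derive1n 2 (gn n t) = heat (Num.sqrt t) (derive1 (derive1 (f n))).
  move=> t0; rewrite gnE//; exact: (derive1n_heat 2 _ (sf n)).1.
have tH : tempered_family `[0, T]%classic (fun t => heat (Num.sqrt t)).
  apply: (tempered_reparam (tempered_heat (Num.sqrt T))) => t /=.
  by rewrite in_itv/= => /andP[_ tT]; rewrite ger0_norm ?sqrtr_ge0// ler_wsqrtr.
have tdt : tempered_family `[0, T]%classic
    (fun t phi => 2^-1 *: heat (Num.sqrt t) (derive1 (derive1 phi))).
  apply: (tempered_scale (c := cst 2^-1) (M := `|2^-1|)) => [t _|]; first by [].
  apply: (tempered_comp tH).
  exact: tempered_comp (@tempered_derive1 _ _) (@tempered_derive1 _ _).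
have sgn n t : 0 <= t <= T -> schwartz (gn n t).
  by move=> /itvP t0; rewrite gnE//; exact: schwartz_heat.
have son n : schwartz_on T (gn n).
  by split=> [t|x]; [exact: sgn|case: (heatE n x)].
have gnH : temperedT_seq T slow_seq gn.
  split=> // [n t tT|m|m].
  - rewrite dtE//; apply/schwartzZ/schwartz_heat.
    by do 2 apply: schwartz_derive1.
  - by apply: (sup_norms_slow hT m hf tH) => n t /itvP; exact: gnE.
  - by apply: (sup_norms_slow hT m hf tdt) => n t; exact: dtE.
have h0 : 0 <= (0 : R) <= T by rewrite lexx ltW.
split.
- by exists gn.
- by move=> t tT; exact: at_time_tclassT.
- move=> t tT; rewrite (Dt_tclassT hT tT son) (Dx2_tclassT hT tT (fun n => sgn n t tT)).
  rewrite tscale_tclass; congr tclass; apply/funext => n.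
  by rewrite dtE// dxE//; exact: itvP tT.
- rewrite (at_time_tclassT hT gn h0); congr tclass; apply/funext => n.
  by rewrite (gnE n 0 (lexx 0)) sqrtr0 heat0.
Qed.
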